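(* Let $Q$ be any finite sequence of elements of $\{1,\dots,n-1\}$. If $3\le k\le n-3$ and $t_k(Q)\le2$, then $$t_j(Q)\le2+\left\lceil\frac{|j-k|}{2}\right\rceil,\qquad 2\le j\le n-2.$$ Consequently, for every $n\times n$ oscillatory matrix $A$ and every $3\le k\le n-3$, $$e_k(A)\le2\ \Longrightarrow\ e_j(A)\le2+\left\lceil\frac{|j-k|}{2}\right\rceil,\qquad 2\le j\le n-2.$$
   Context: All matrices are real. A matrix is totally nonnegative (TN) if all its minors are $\ge0$ and totally positive (TP) if all its minors are $>0$; a square TN matrix is oscillatory if some positive power of it is TP. For an $n\times n$ oscillatory matrix $A$ and $1\le k\le n$, $e_k(A)=\min\{m\ge1:\text{all minors of order }k\text{ of }A^m\text{ are positive}\}$. For $a\in\{1,\dots,n-1\}$ and $I\subseteq\{1,\dots,n\}$, let $c_a^+(I)=(I\setminus\{a\})\cup\{a+1\}$ if $a\in I$ and $a+1\notin I$, and $c_a^+(I)=I$ otherwise. For a finite sequence $Q=(q_1,\dots,q_\ell)$ in $\{1,\dots,n-1\}$, a $Q$-pass applies $c_{q_1}^+,\dots,c_{q_\ell}^+$ successively, in that order ($c_{q_1}^+$ first). With $L_k=\{1,\dots,k\}$ and $R_k=\{n-k+1,\dots,n\}$, $t_k(Q)$ is the least number $m\ge1$ of repeated $Q$-passes carrying $L_k$ to $R_k$, with $t_k(Q)=\infty$ if this never occurs. *)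

(* Defs.v *)
From mathcomp Require Import all_boot all_order all_algebra.
From mathcomp Require Import boolp reals.

Set Implicit Arguments.
Unset Strict Implicit.
Unset Printing Implicit Defensive.

Import Order.TTheory GRing.Theory Num.Theory.
Local Open Scope nat_scope.

(* Extended naturals are [option nat], with [None] standing for infinity. *)
Definition least (P : pred nat) : option nat :=
  if pselect (exists m, P m) is left exP then Some (ex_minn exP) else None.

Definition ele (x : option nat) (b : nat) : bool :=
  if x is Some m then m <= b else false.

(* A minor of order k is the determinant of the submatrix whose rows and
   columns are selected by strictly increasing maps 'I_k -> 'I_n. The order 0
   is harmless below: the empty minor is 1. *)
Definition minors_ge0 (R : realType) n k (A : 'M[R]_n) : Prop :=
  forall f g : 'I_k -> 'I_n,
    {homo f : i j / i < j} -> {homo g : i j / i < j} ->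
    (0 <= \det (mxsub f g A))%R.

Definition minors_gt0 (R : realType) n k (A : 'M[R]_n) : Prop :=
  forall f g : 'I_k -> 'I_n,
    {homo f : i j / i < j} -> {homo g : i j / i < j} ->
    (0 < \det (mxsub f g A))%R.

Definition totally_nonnegative (R : realType) n (A : 'M[R]_n) : Prop :=
  forall k, minors_ge0 k A.

Definition totally_positive (R : realType) n (A : 'M[R]_n) : Prop :=
  forall k, minors_gt0 k A.

Definition oscillatory (R : realType) n (A : 'M[R]_n) : Prop :=
  totally_nonnegative A /\
  exists m, 0 < m /\ totally_positive (A ^+ m)%R.

(* e_k(A); never [None] when A is oscillatory. *)
Definition exponent (R : realType) n (k : nat) (A : 'M[R]_n) : option nat :=
  least (fun m => (0 < m) && `[< minors_gt0 k (A ^+ m)%R >]).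

(* Indices are counted from 0: {1, ..., n} is 'I_n, and {1, ..., n-1} is
   'I_n.-1, whose element a yields the two elements a and a + 1 of 'I_n. *)
Definition lower n (a : 'I_n.-1) : 'I_n := widen_ord (leq_pred n) a.

Lemma upper_subproof n (a : 'I_n.-1) : a.+1 < n.
Proof. by rewrite -ltn_predRL. Qed.

Definition upper n (a : 'I_n.-1) : 'I_n := Ordinal (upper_subproof a).

Definition cplus n (a : 'I_n.-1) (I : {set 'I_n}) : {set 'I_n} :=
  if (lower a \in I) && (upper a \notin I)
  then upper a |: (I :\ lower a) else I.

Definition pass n (Q : seq 'I_n.-1) (I : {set 'I_n}) : {set 'I_n} :=
  foldl (fun J q => cplus q J) I Q.

Definition Lset n (k : nat) : {set 'I_n} := [set i : 'I_n | i < k].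
Definition Rset n (k : nat) : {set 'I_n} := [set i : 'I_n | n - k <= i].

(* t_k(Q) *)
Definition passes n (k : nat) (Q : seq 'I_n.-1) : option nat :=
  least (fun m => (0 < m) && (iter m (pass Q) (Lset n k) == Rset n k)).

(* Main.v *)
Require Import Defs.
From mathcomp Require Import all_boot all_order all_algebra fingroup perm.
From mathcomp Require Import boolp reals zify.

(** Words and matrices obey the same arithmetic. For a word Q let c(p, q) be the
    number of elements above q in the image of {1, ..., p} under one Q-pass; for
    an invertible totally nonnegative matrix A let c(p, q) be the rank of the
    corner of A formed by the rows <= p and the columns > q. In both cases c
    satisfies a Monge inequality and has the boundary values of a permutation
    matrix ([rank_profile]), and iteration is a min-plus power: the number
    attached to m passes, or to A^m, is the least cost c(v_0, v_1) + ... +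
    c(v_(m-1), v_m) of a chain from v_0 = p to v_m = q. Consequently t_k(Q) <= m
    says that every chain of m steps from k to n - k costs at least k
    ([covers], [ele_passes]), and e_k(A) <= m says the same of the profiles of A
    and of its transpose ([ele_exponent]). Everything then follows from a
    statement about rank profiles, [covers_dist].

    Its core is [covers_step]: one more step of the chains pays for raising k'
    to j = k' + 1 or j = k' + 2. Let v be a chain of m + 1 steps from j to n - j
    of cost less than j. By the Monge inequality, a local extremum x of the
    chain can be skipped, and this saves c(x, x); since chains of m steps are
    not cheap for k', this forces c(x, x) <= 1. But chains of two steps are not
    cheap for k, and the chain x, x, x then shows that c(x, x) is at least 2 as
    soon as 3 <= x <= n - 3. Hence the extrema of v are close to 0 or n. Neither the
    first nor the last step of v can go down, and v_1 <= v_m is excluded by the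
    two-step hypothesis; so v has a maximum, at least n - 2, followed by a
    minimum, at most 2, and going down from the former to the latter is already
    too expensive. The values j < k come from the reflection p -> n - p, which
    turns c(p, q) into c(n - p, n - q) + p - q.

    For words, the min-plus law holds because a letter a replaces the number
    N(a) of elements above a by min(N(a - 1), N(a + 1) + 1). For matrices, one
    half of it is the subadditivity of the rank. The other half
    ([corner_mul_ge]) rests on total nonnegativity: the rank of an arbitrary set
    of rows, restricted to the last columns, is determined by the corners
    ([rank_rows]), because a row that depends on earlier rows forces all rows
    above it to do so ([span_below]). Otherwise two minors of consecutive sizes,
    bordered by the same row and column, would have opposite signs. The passage
    from the two extreme corners to all minors of order k
    ([minors_gt0_of_corners]) uses the same bordering. *)

Set Implicit Arguments.
Unset Strict Implicit.
Unset Printing Implicit Defensive.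

Import Order.TTheory GRing.Theory Num.Theory.
Local Open Scope nat_scope.

(** * Rank profiles and the cost of chains *)

Record rank_profile (n : nat) (c : nat -> nat -> nat) : Prop := RankProfile {
  profile_monge : forall p1 p2 q1 q2,
    p1 <= p2 -> p2 <= n -> q1 <= q2 -> q2 <= n ->
    c p1 q1 + c p2 q2 <= c p2 q1 + c p1 q2;
  profile_p0 : forall p, p <= n -> c p 0 = p;
  profile_pn : forall p, p <= n -> c p n = 0;
  profile_0q : forall q, q <= n -> c 0 q = 0;
  profile_nq : forall q, q <= n -> c n q = n - q }.

Definition cost (c : nat -> nat -> nat) (v : nat -> nat) (a b : nat) : nat :=
  \sum_(a <= i < b) c (v i) (v i.+1).

(** The chain need not join k to n - k: by the unit-step property of profiles,
    moving an end changes the cost by no more than the two truncated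
    differences. Any part of a chain can thus be compared with k directly. *)
Definition covers (c : nat -> nat -> nat) (n m k : nat) : Prop :=
  forall v : nat -> nat, (forall i, v i <= n) ->
    k <= cost c v 0 m + (k - v 0) + (v m - (n - k)).

(** The Monge inequality against the columns 0 and n, where c is known, bounds
    the increments of c in its first argument by 0 and 1. *)
Lemma profile_rows n c p p' q :
  rank_profile n c -> p <= p' <= n -> q <= n -> c p q <= c p' q <= c p q + (p' - p).
Proof.
move=> H /andP[lep len] leq.
have := profile_monge H lep len leq (leqnn n).
have := profile_monge H lep len (leq0n q) leq.
rewrite !(profile_p0 H) ?(profile_pn H); lia.
Qed.

Lemma profile_cols n c p q q' :
  rank_profile n c -> p <= n -> q <= q' <= n -> c p q' <= c p q <= c p q' + (q' - q).
Proof.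
move=> H lep /andP[leq len].
have := profile_monge H (leq0n p) lep leq len.
have := profile_monge H lep (leqnn n) leq len.
rewrite !(profile_0q H) ?(profile_nq H); lia.
Qed.

Lemma profile_ge n c p q : rank_profile n c -> p <= n -> q <= n -> p - q <= c p q.
Proof.
move=> H lep leq.
by have := @profile_cols n _ p 0 q H lep leq; rewrite (profile_p0 H) //; lia.
Qed.

Lemma cost_cat c v a b d : a <= b <= d -> cost c v a d = cost c v a b + cost c v b d.
Proof. by move=> /andP[ab bd]; rewrite /cost (big_cat_nat ab bd). Qed.

Lemma cost1 c v a : cost c v a a.+1 = c (v a) (v a.+1).
Proof. by rewrite /cost big_nat1. Qed.

Lemma cost_ge n c v a b : rank_profile n c -> (forall i, v i <= n) -> a <= b ->
  v a - v b <= cost c v a b.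
Proof.
move=> H vn; elim: b => [|b IH]; first by rewrite leqn0 => /eqP->; rewrite subnn.
rewrite leq_eqVlt ltnS => /orP[/eqP->|ab]; first by rewrite subnn.
rewrite (@cost_cat _ _ _ b) ?ab //= cost1.
have := IH ab; have := profile_ge H (vn b) (vn b.+1); lia.
Qed.

Lemma eq_cost c v v' a b : (forall i, a <= i <= b -> v i = v' i) ->
  cost c v a b = cost c v' a b.
Proof.
move=> E; rewrite /cost big_nat [RHS]big_nat; apply: eq_bigr => i /andP[ai ib].
by rewrite !E; lia.
Qed.

Lemma cost_shift c v d a b : cost c (fun i => v (i + d)) a b = cost c v (a + d) (b + d).
Proof. by rewrite /cost big_addn addnK; apply: eq_bigr => i _; rewrite addSn. Qed.

Lemma covers_pinned n c m k : rank_profile n c -> 0 < m -> k <= n ->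
  (forall v : nat -> nat, (forall i, v i <= n) -> v 0 = k -> v m = n - k ->
     k <= cost c v 0 m) -> covers c n m k.
Proof.
case: m => // m H _ kn F v vn.
pose v' i := if i == 0 then k else v i.
pose v2 i := if i == m.+1 then n - k else v' i.
have v'n i : v' i <= n by rewrite /v'; case: ifP.
have v2n i : v2 i <= n by rewrite /v2; case: ifP => // _; lia.
have v2m : v2 m.+1 = n - k by rewrite /v2 eqxx.
apply: leq_trans (F v2 v2n erefl v2m) _.
apply: (@leq_trans (cost c v' 0 m.+1 + (v' m.+1 - (n - k)))).
  rewrite !(@cost_cat _ _ 0 m m.+1) ?leqnSn //= !cost1 v2m.
  rewrite (@eq_cost c v2 v'); last by move=> i /andP[_ im]; rewrite /v2; case: eqP => //; lia.
  have -> : v2 m = v' m by rewrite /v2; case: eqP => //; lia.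
  have := v'n m; have := v'n m.+1 => a b.
  have := @profile_cols n _ (v' m) (n - k) (v' m.+1) H b.
  have := @profile_cols n _ (v' m) (v' m.+1) (n - k) H b.
  lia.
rewrite {2}/v' leq_add2r.
rewrite !(@cost_cat _ _ 0 1 m.+1) // !cost1.
rewrite (@eq_cost c v' v 1); last by move=> [].
rewrite /v' /=; have := vn 0; have := vn 1 => a b.
have := @profile_rows n _ k (v 0) (v 1) H; have := @profile_rows n _ (v 0) k (v 1) H.
lia.
Qed.

Lemma covers_monotone n c m m' k : rank_profile n c -> k <= n -> 0 < m <= m' ->
  covers c n m k -> covers c n m' k.
Proof.
move=> H kn /andP[m0 /subnK<-]; elim: (m' - m) => // d IH C v vn.
rewrite addSn (@cost_cat _ _ 0 (d + m)) ?leqnSn // cost1.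
have := IH C v vn; have := profile_ge H (vn (d + m)) (vn (d + m).+1); lia.
Qed.

Lemma covers2 n c k x y z : covers c n 2 k -> x <= n -> y <= n -> z <= n ->
  k <= c x y + c y z + (k - x) + (z - (n - k)).
Proof.
move=> H xn yn zn; have := H (nth z [:: x; y]).
rewrite /cost 2?big_nat_recr //= big_nil /= add0n; apply.
by case=> [|[|i]] //=; rewrite nth_nil.
Qed.

(** At a local extremum of the chain the Monge inequality exchanges the targets
    of two consecutive steps: the step that jumps over v i, together with the
    loop at v i, costs no more than the two original steps. *)
Lemma covers_skip n c m k v i : rank_profile n c -> covers c n m k ->
  (forall i, v i <= n) -> 0 < i <= m ->
  (v i.-1 <= v i) && (v i.+1 <= v i) || (v i <= v i.-1) && (v i <= v i.+1) ->
  k + c (v i) (v i) <= cost c v 0 m.+1 + (k - v 0) + (v m.+1 - (n - k)).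
Proof.
move=> H C vn; case: i => // i /= im ext.
(* After [case], the skipped index is i.+1. *)
pose v' t := v (t + (i < t)).
have := C v' (fun t => vn _).
have -> : v' m = v m.+1 by rewrite /v' im addn1.
have -> : v' 0 = v 0 by rewrite /v' ltn0.
rewrite (@cost_cat c v' 0 i m) ?(@cost_cat c v' i i.+1 m) ?cost1; try lia.
rewrite (@cost_cat c v 0 i m.+1) ?(@cost_cat c v i i.+1 m.+1) ?(@cost_cat c v i.+1 i.+2 m.+1) ?cost1; try lia.
rewrite (@eq_cost c v' v 0 i); last by move=> t ?; rewrite /v' ltnNge; case: leqP; rewrite ?addn0 //; lia.
rewrite (@eq_cost c v' (fun t => v (t + 1)) i.+1 m); last by move=> t ?; rewrite /v'; case: ltnP => //; lia.
rewrite cost_shift !addn1.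
have -> : v' i = v i by rewrite /v' ltnn addn0.
have -> : v' i.+1 = v i.+2 by rewrite /v' ltnSn addn1.
have : c (v i) (v i.+2) + c (v i.+1) (v i.+1) <= c (v i) (v i.+1) + c (v i.+1) (v i.+2).
  case/orP: ext => /andP[e1 e2].
    by have := profile_monge H e1 (vn _) e2 (vn _); lia.
  by have := profile_monge H e1 (vn _) e2 (vn _); lia.
lia.
Qed.

(** * The step that raises k *)

Lemma diag_ge2 n c k x : covers c n 2 k -> 3 <= k <= n - 3 -> 3 <= x <= n - 3 -> 2 <= c x x.
Proof.
move=> C2 kn xn; have xln : x <= n by move: xn; clear; lia.
by have := covers2 C2 xln xln xln; move: kn xn; clear; lia.
Qed.

Lemma diag_gt0 n c k x : covers c n 2 k -> 0 < k < n -> 0 < x < n -> 0 < c x x.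
Proof.
move=> C2 kn xn; have xln : x <= n by move: xn; clear; lia.
by have := covers2 C2 xln xln xln; move: kn xn; clear; lia.
Qed.

(** The loops c x x have cost at least 2 in the middle range, by the two-step
    hypothesis, and at most 1 at the extrema of a chain that would be too cheap.
    Such a chain therefore descends from n - 2 or more to 2 or less, which costs
    at least n - 4; the remaining cases j >= n - 3 are settled by what the chain
    pays to leave j and to arrive at n - j. *)
Lemma covers_step n c m k k' j : rank_profile n c -> covers c n 2 k -> covers c n m k' ->
  1 < m -> 3 <= k <= n - 3 -> k <= k' -> k' < j <= k'.+2 -> j <= n - 2 -> covers c n m.+1 j.
Proof.
move=> H C2 Cm m1 kn kk' kj jn.
have jln : j <= n by move: jn; clear; lia.
have j4 : 4 <= j by move: kn kk' kj; clear; lia.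
have njn : n - j <= n by apply: leq_subr.
apply: covers_pinned => // v vn v0 vm.
rewrite leqNgt; apply/negP => bad.
have n1 := vn 1; have nm := vn m.
have S1 : cost c v 0 m.+1 = c j (v 1) + cost c v 1 m.+1.
  by rewrite (@cost_cat c v 0 1) // cost1 v0.
have Sm : cost c v 0 m.+1 = cost c v 0 m + c (v m) (n - j).
  by rewrite (@cost_cat c v 0 m) ?leqnSn // cost1 vm.
(* The hypothesis for k' on the rest of the chain excludes a first step to k' or
   below, and a step to j - 1 would cost at least c (j - 1) (j - 1) >= 2. *)
have [jv1 c1] : j <= v 1 /\ c j (v 1) <= 1.
  have B1 := Cm (fun i => v (i + 1)) (fun i => vn _).
  rewrite cost_shift add0n !addn1 vm in B1.
  have lo := profile_ge H jln n1.
  have k'v1 : k' < v 1 by move: bad S1 B1 lo kj; clear; lia.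
  have c1 : c j (v 1) <= 1 by move: bad S1 B1 k'v1 kj; clear; lia.
  split=> //; rewrite leqNgt; apply/negP => v1j.
  have in1 : 3 <= v 1 <= n - 3 by move: k'v1 v1j kn kk' jn; clear; lia.
  have := diag_ge2 C2 kn in1; rewrite leqNgt ltnS; apply/negP; rewrite negbK.
  have := @profile_rows n _ (v 1) j (v 1) H; rewrite (ltnW v1j) jln n1.
  by case/(_ isT isT)/andP => /leq_trans + _; apply.
have [vmj cm] : v m <= n - j /\ c (v m) (n - j) <= 1.
  have Bm := Cm v vn; rewrite v0 in Bm.
  have lo := profile_ge H nm njn.
  have k'vm : v m < n - k' by move: bad Sm Bm lo kj jn; clear; lia.
  have cm : c (v m) (n - j) <= 1 by move: bad Sm Bm k'vm kj; clear; lia.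
  split=> //; rewrite leqNgt; apply/negP => jvm.
  have inm : 3 <= v m <= n - 3 by move: k'vm jvm kn kk' kj jn; clear; lia.
  have := diag_ge2 C2 kn inm; rewrite leqNgt ltnS; apply/negP; rewrite negbK.
  have := @profile_cols n _ (v m) (n - j) (v m) H nm; rewrite (ltnW jvm) nm.
  by case/(_ isT)/andP => /leq_trans + _; apply.
(* Otherwise j, v 1, n - j would be a chain of two steps of cost at most 2. *)
have vm1 : v m < v 1.
  rewrite ltnNge; apply/negP => le1m.
  have := covers2 C2 jln n1 njn.
  have := @profile_rows n _ (v 1) (v m) (n - j) H; rewrite le1m nm njn => /(_ isT isT).
  by move: c1 cm kn kk' kj; clear; lia.
pose i0 : 'I_m.+1 := inord 1.
have i0E : i0 = 1 :> nat by rewrite inordK //; apply: ltnW.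
case: (@arg_maxnP _ i0 (fun i : 'I_m.+1 => 0 < i) (fun i : 'I_m.+1 => v i)) => [|i ipos imax].
  by rewrite i0E.
have v1i : v 1 <= v i by have := imax i0; rewrite i0E; apply.
have im : i < m.
  have := ltn_ord i; rewrite ltnS leq_eqVlt => /orP[/eqP E|//].
  by move: v1i; rewrite E leqNgt vm1.
case: (@arg_minnP _ (ord_max : 'I_m.+1) (fun l : 'I_m.+1 => i <= l) (fun i : 'I_m.+1 => v i)) => [|l il lmin].
  by rewrite -ltnS.
have vlm : v l <= v m by apply: (lmin ord_max); rewrite /= -ltnS.
have li : i < l.
  rewrite ltn_neqAle il andbT; apply/eqP => E; move: v1i; rewrite E leqNgt => /negP; apply.
  exact: leq_ltn_trans vlm vm1.
have lm : l <= m by rewrite -ltnS.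
(* The hypothesis for k' on the chain without v t; the cost is at most k' + 1. *)
have skip t : 0 < t <= m ->
    (v t.-1 <= v t) && (v t.+1 <= v t) || (v t <= v t.-1) && (v t <= v t.+1) ->
    c (v t) (v t) <= 1.
  move=> tm ext; have := covers_skip H Cm vn tm ext; rewrite v0 vm.
  by move: bad kj; clear; lia.
have ci : c (v i) (v i) <= 1.
  apply: skip; first by rewrite ipos ltnW.
  apply/orP; left; apply/andP; split.
    case: (posnP i.-1) => [->|p]; first by rewrite v0 (leq_trans jv1).
    have := imax (inord i.-1); rewrite inordK; first exact.
    exact: leq_ltn_trans (leq_pred _) (ltn_ord i).
  by have := imax (inord i.+1); rewrite inordK // ltnS; apply.
have cl : c (v l) (v l) <= 1.
  apply: skip; first by rewrite lm (leq_trans _ li).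
  apply/orP; right; apply/andP; split.
    have := lmin (inord l.-1); rewrite inordK; last exact: leq_ltn_trans (leq_pred _) (ltn_ord l).
    by apply; move: li; clear; lia.
  have := lm; rewrite leq_eqVlt => /orP[/eqP E|lm'].
    by rewrite E vm.
  by have := lmin (inord l.+1); rewrite inordK //; apply; apply: leqW.
have Hi : n - 2 <= v i.
  rewrite leqNgt; apply/negP => vi2.
  have ini : 3 <= v i <= n - 3 by move: vi2 v1i jv1 j4; clear; lia.
  by have := diag_ge2 C2 kn ini; rewrite leqNgt ltnS ci.
have Hl : v l <= 2.
  rewrite leqNgt; apply/negP => vl2.
  have inl : 3 <= v l <= n - 3 by rewrite vl2; move: vlm vmj j4; clear; lia.
  by have := diag_ge2 C2 kn inl; rewrite leqNgt ltnS cl.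
have D1 : cost c v 1 m.+1 = cost c v 1 i + cost c v i m.+1.
  by apply: cost_cat; rewrite ipos ltnW // ltnW.
have D2 : cost c v i m.+1 = cost c v i l + cost c v l m.+1.
  by apply: cost_cat; rewrite il ltnW.
have D3 : cost c v l m.+1 = cost c v l m + c (v m) (n - j).
  by rewrite (@cost_cat c v l m) ?cost1 ?vm // lm /=.
have Dil := cost_ge H vn (ltnW li).
have low : c j (v 1) + (v i - v l) + c (v m) (n - j) < j.
  by move: bad S1 D1 D2 D3 Dil; clear; lia.
have j3 : n - 3 <= j by move: low Hi Hl; clear; lia.
(* For j = n - 2 the inner bound is out of reach, but a positive loop is enough. *)
have diag x : x = j \/ x = n - j -> n - j <= (c x x).+1.
  have [jE|jE] : j = n - 3 \/ j = n - 2 by move: j3 jn; clear; lia.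
    move=> xE; have inx : 3 <= x <= n - 3 by move: xE jE j4 jn; clear; lia.
    by have := diag_ge2 C2 kn inx; move: jE; clear; lia.
  move=> xE; have inx : 0 < x < n by move: xE jE j4 jn; clear; lia.
  have k0 : 0 < k < n by move: kn; clear; lia.
  by have := diag_gt0 C2 k0 inx; move: jE; clear; lia.
have := diag j (or_introl erefl); have := diag (n - j) (or_intror erefl).
have := @profile_cols n _ j j (v 1) H jln; rewrite jv1 n1 => /(_ isT)/andP[_].
have := @profile_rows n _ (v m) (n - j) (n - j) H; rewrite vmj njn => /(_ isT isT)/andP[_].
by move: low v1i vlm jv1 vmj jn Hi j4; clear; lia.
Qed.

(** * Reflection *)

(** Reflecting indices exchanges the top right corner with the bottom left one;
    for permutation matrices the corner counts of the two differ by p - q. The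
    truncated subtraction is exact by [profile_ge]. *)
Definition mirror (n : nat) (c : nat -> nat -> nat) (p q : nat) : nat :=
  c (n - p) (n - q) + p - q.

Lemma mirrorE n c p q : rank_profile n c -> p <= n -> q <= n ->
  mirror n c p q + q = c (n - p) (n - q) + p.
Proof.
move=> H pn qn; have := profile_ge H (leq_subr p n) (leq_subr q n).
by rewrite /mirror; move: pn qn; clear; lia.
Qed.

Lemma mirror_profile n c : rank_profile n c -> rank_profile n (mirror n c).
Proof.
move=> H; split=> [p1 p2 q1 q2 p12 p2n q12 q2n|p pn|p pn|q qn|q qn].
- have p1n := leq_trans p12 p2n; have q1n := leq_trans q12 q2n.
  have := profile_monge H
    (leq_sub2l n p12) (leq_subr _ _) (leq_sub2l n q12) (leq_subr _ _).
  have := mirrorE H p1n q1n; have := mirrorE H p1n q2n.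
  have := mirrorE H p2n q1n; have := mirrorE H p2n q2n.
  by clear; lia.
- by rewrite /mirror !subn0 (profile_pn H) ?leq_subr.
- by rewrite /mirror subnn (profile_p0 H) ?leq_subr // subnK // subnn.
- by rewrite /mirror subn0 (profile_nq H) ?leq_subr // addn0 subKn // subnn.
- by rewrite /mirror subnn (profile_0q H) ?leq_subr.
Qed.

Lemma cost_mirror n c v m : rank_profile n c -> (forall i, v i <= n) ->
  cost (mirror n c) v 0 m + v m = cost c (fun i => n - v i) 0 m + v 0.
Proof.
move=> H vn; elim: m => [|m IH]; first by rewrite /cost !big_geq.
rewrite !(@cost_cat _ _ 0 m m.+1) ?leqnSn // !cost1.
by have := mirrorE H (vn m) (vn m.+1); move: IH; clear; lia.
Qed.

Lemma covers_mirror n c m k : rank_profile n c -> k <= n ->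
  covers c n m k -> covers (mirror n c) n m (n - k).
Proof.
move=> H kn C v vn.
have := C (fun i => n - v i) (fun i => leq_subr _ _).
have := cost_mirror m H vn; have := vn 0; have := vn m.
by move: kn => /=; clear; lia.
Qed.

Lemma mirrorK n c p q : rank_profile n c -> p <= n -> q <= n -> mirror n (mirror n c) p q = c p q.
Proof.
move=> H pn qn; rewrite /mirror !subKn //.
by have := profile_ge H pn qn; move: pn qn; clear; lia.
Qed.

Lemma covers_mirrorK n c m k : rank_profile n c -> k <= n ->
  covers (mirror n c) n m (n - k) -> covers c n m k.
Proof.
move=> H kn C v vn.
have := covers_mirror (mirror_profile H) (leq_subr _ _) C vn.
rewrite subKn // /cost; congr (_ <= _ + _ + _).
by apply: eq_bigr => i _; rewrite mirrorK.
Qed.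

Lemma covers_ge n c k j : rank_profile n c -> covers c n 2 k ->
  3 <= k <= n - 3 -> k <= j <= n - 2 -> covers c n (2 + uphalf (j - k)) j.
Proof.
move=> H C2 kn; elim/ltn_ind: j => j IH /andP[kj jn].
have [jk|] := leqP j k; first by have -> : j = k by [lia]; rewrite subnn.
rewrite leq_eqVlt => /orP[/eqP<-|kj2].
  by rewrite subSnn /= addn1; apply: (covers_step H C2 C2); lia.
have -> : 2 + uphalf (j - k) = (2 + uphalf (j.-2 - k)).+1.
  by rewrite -addnS; congr (_ + _); have -> : j - k = (j.-2 - k).+2 by lia.
have Cj : covers c n (2 + uphalf (j.-2 - k)) j.-2 by apply: IH; lia.
by apply: (covers_step H C2 Cj); lia.
Qed.

Lemma covers_dist n c k j : rank_profile n c -> covers c n 2 k ->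
  3 <= k <= n - 3 -> 2 <= j <= n - 2 -> covers c n (2 + uphalf `|j - k|) j.
Proof.
move=> H C2 kn jn; have [kj|jk] := leqP k j.
  by have -> : `|j - k| = (j - k)%N by [lia]; apply: covers_ge => //; lia.
apply: covers_mirrorK => //; first by lia.
have -> : `|j - k| = (n - j - (n - k))%N by lia.
apply: covers_ge; [exact: mirror_profile| |lia|lia].
by apply: covers_mirror => //; lia.
Qed.

(** * Profiles of words *)

Definition tail (n : nat) (I : {set 'I_n}) (q : nat) : nat := #|[set i in I | q <= i]|.

Lemma tailU1 n (I : {set 'I_n}) x q : x \notin I -> tail (x |: I) q = tail I q + (q <= x).
Proof.
move=> xI; rewrite /tail.
have [qx|qx] := leqP q x; last first.
  rewrite addn0; congr #|pred_of_set _|; apply/setP => i; rewrite !inE.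
  by case: eqP => [->|//]; rewrite leqNgt qx andbF andbF.
rewrite addn1 -[RHS]add1n.
have -> : 1 = (x \notin [set i in I | q <= i]) by rewrite inE (negPf xI).
rewrite -cardsU1; congr #|pred_of_set _|; apply/setP => i; rewrite !inE.
by case: eqP => [->|].
Qed.

Lemma tail_step n (I : {set 'I_n}) (x : 'I_n) : tail I x = (x \in I) + tail I x.+1.
Proof.
rewrite /tail; have [xI|xI] := boolP (x \in I); last first.
  congr #|pred_of_set _|; apply/setP => i; rewrite !inE leq_eqVlt.
  by case: eqP => [/val_inj<-|//]; rewrite (negPf xI).
have -> : true = (x \notin [set i in I | x < i]) by rewrite inE ltnn andbF.
rewrite -cardsU1; congr #|pred_of_set _|; apply/setP => i; rewrite !inE leq_eqVlt.
have [->|ne] := eqVneq i x; first by rewrite xI eqxx.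
by rewrite (_ : (nat_of_ord x == i) = false) //; apply/negbTE; rewrite eq_sym.
Qed.

(** The min-plus form of a single move: the element a moves to a + 1 exactly when
    both arguments of the minimum exceed the previous count. *)
Lemma tail_cplus n (I : {set 'I_n}) (a : 'I_n.-1) q :
  tail (cplus a I) q = if q == a.+1 then minn (tail I a) (tail I a.+2).+1 else tail I q.
Proof.
have La := tail_step I (lower a); have Ua := tail_step I (upper a).
rewrite /= in La Ua; rewrite /cplus; case: ifP => [/andP[aI uI]|]; last first.
  by case: eqP => // -> ; move: La Ua; case: (lower a \in I); case: (upper a \in I) => //=; lia.
have E : lower a |: (I :\ lower a) = I by rewrite setD1K.
have T t : tail I t = tail (I :\ lower a) t + (t <= a).
  by rewrite -{1}E tailU1 // !inE eqxx.
rewrite tailU1 ?inE ?(negPf uI) ?andbF //=.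
have := T q; have := T a; have := T a.+2; have := T a.+1; move: La Ua.
by rewrite aI (negPf uI); case: eqP => [->|] ; lia.
Qed.

Lemma tail_le n (I : {set 'I_n}) q q' : q <= q' -> tail I q' <= tail I q <= tail I q' + (q' - q).
Proof.
move=> /subnK<-; elim: (q' - q) => [|d IH]; first by rewrite subnn addn0 leqnn.
suff: tail I (d.+1 + q) <= tail I (d + q) <= (tail I (d.+1 + q)).+1 by lia.
have [h|h] := ltnP (d + q) n.
  by have := tail_step I (Ordinal h) => /= ->; case: (_ \in _); rewrite ?addSn /=; lia.
have z t : n <= t -> tail I t = 0.
  move=> nt; apply/eqP; rewrite cards_eq0 -subset0; apply/subsetP => i.
  by rewrite inE => /andP[_ ti]; have := ltn_ord i; lia.
by rewrite !z; lia.
Qed.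

Lemma tailn n (I : {set 'I_n}) : tail I n = 0.
Proof.
apply/eqP; rewrite cards_eq0 -subset0; apply/subsetP => i.
by rewrite inE => /andP[_]; rewrite leqNgt ltn_ord.
Qed.

Lemma tail0 n (I : {set 'I_n}) : tail I 0 = #|I|.
Proof. by congr #|pred_of_set _|; apply/setP => i; rewrite inE andbT. Qed.

Lemma card_ord_lt n p : p <= n -> #|[set i : 'I_n | i < p]| = p.
Proof.
move=> pn; have inj : injective (widen_ord pn) by move=> x y [] /val_inj.
rewrite -[RHS]card_ord -(card_image inj); apply: eq_card => i; rewrite inE.
apply/idP/imageP => [ip|[x _ ->]]; last exact: (ltn_ord x).
by exists (Ordinal ip) => //; apply: val_inj.
Qed.

Lemma tail_Lset n p q : p <= n -> q <= n -> tail (Lset n p) q = p - q.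
Proof.
move=> pn qn; have c0 : tail (Lset n p) 0 = p by rewrite tail0 card_ord_lt.
have [qp|pq] := leqP q p; last first.
  rewrite (eqP (ltnW pq : p - q == 0)); apply/eqP; rewrite cards_eq0 -subset0.
  by apply/subsetP => i; rewrite !inE; lia.
have cq : tail (Lset n p) p = 0.
  by apply/eqP; rewrite cards_eq0 -subset0; apply/subsetP => i; rewrite !inE; lia.
have := @tail_le n (Lset n p) 0 q (leq0n _); have := @tail_le n (Lset n p) q p qp; lia.
Qed.

(** Two configurations driven by the same word stay nested, as in the basic
    coupling of exclusion processes; this gives the Monge inequality for words. *)
Lemma cplusS n (a : 'I_n.-1) (I J : {set 'I_n}) : I \subset J -> cplus a I \subset cplus a J.
Proof.
move=> /subsetP IJ; apply/subsetP => i; rewrite /cplus.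
case: ifP => [/andP[aI uI]|nI]; case: ifP => [/andP[aJ uJ]|nJ]; rewrite ?inE.
- by case/orP=> [->//|/andP[-> /IJ->]]; rewrite orbT.
- move: nJ; rewrite (IJ _ aI) /= => /negbFE uJ.
  by case/orP=> [/eqP->//|/andP[_ /IJ]].
- move=> iI; rewrite (IJ _ iI) andbT orbC.
  case: eqVneq iI => //= -> aI; move: nI; rewrite aI /= => /negbFE/IJ.
  by rewrite (negPf uJ).
- exact: IJ.
Qed.

Lemma passS n (Q : seq 'I_n.-1) (I J : {set 'I_n}) :
  I \subset J -> pass Q I \subset pass Q J.
Proof. by elim: Q I J => //= a Q IH I J IJ; apply/IH/cplusS. Qed.

Lemma card_pass n (Q : seq 'I_n.-1) (I : {set 'I_n}) : #|pass Q I| = #|I|.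
Proof. by elim: Q I => //= a Q IH I; rewrite IH -!tail0 tail_cplus. Qed.

Definition word_profile n (Q : seq 'I_n.-1) (p q : nat) : nat := tail (pass Q (Lset n p)) q.

Lemma subset_tail_diff n (I J : {set 'I_n}) q q' : I \subset J -> q <= q' ->
  tail I q + tail J q' <= tail J q + tail I q'.
Proof.
move=> IJ qq'.
have D (K : {set 'I_n}) : tail K q = tail K q' + #|[set i in K | q <= i < q']|.
  rewrite /tail -cardsUI [X in _ = _ + X](_ : _ = 0) ?addn0.
    by congr #|pred_of_set _|; apply/setP => i; rewrite !inE; case: (_ \in _) => //=; lia.
  by apply/eqP; rewrite cards_eq0 -subset0; apply/subsetP => i; rewrite !inE; lia.
rewrite (D I) (D J); suff : #|[set i in I | q <= i < q']| <= #|[set i in J | q <= i < q']| by lia.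
by apply: subset_leq_card; apply/subsetP => i; rewrite !inE => /andP[/(subsetP IJ)->].
Qed.

Lemma word_rank_profile n (Q : seq 'I_n.-1) : rank_profile n (word_profile Q).
Proof.
have card_p p : p <= n -> #|pass Q (Lset n p)| = p by move=> pn; rewrite card_pass card_ord_lt.
split=> [p1 p2 q1 q2 p12 p2n q12 q2n|p pn|p pn|q qn|q qn]; rewrite /word_profile.
- apply: subset_tail_diff => //; apply: passS; apply/subsetP => i; rewrite !inE; lia.
- by rewrite tail0 card_p.
- exact: tailn.
- have := @tail_le n (pass Q (Lset n 0)) 0 q; rewrite tail0 card_p //; lia.
- have -> : pass Q (Lset n n) = setT.
    by apply/eqP; rewrite eqEcard subsetT card_p // cardsT card_ord leqnn.
  rewrite -(tail_Lset (leqnn n) qn); congr tail; apply/setP => i; by rewrite !inE ltn_ord.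
Qed.

(** A pass is min-plus linear: its effect on any configuration is determined by
    its effect on the initial segments. *)
Lemma pass_tail n (Q : seq 'I_n.-1) (I : {set 'I_n}) q : q <= n ->
  (forall p, p <= n -> tail (pass Q I) q <= tail I p + word_profile Q p q) /\
  (exists2 p, p <= n & tail (pass Q I) q = tail I p + word_profile Q p q).
Proof.
rewrite /word_profile; elim/last_ind: Q q => [|Q a IH] q qn /=.
  split=> [p pn|].
    by rewrite tail_Lset //; have := @tail_le n I p q; have := @tail_le n I q p; lia.
  by exists q => //; rewrite tail_Lset // subnn addn0.
have E J : pass (rcons Q a) J = cplus a (pass Q J) by rewrite /pass foldl_rcons.
rewrite E tail_cplus; case: (altP (q =P a.+1)) => qa; last first.
  have [le [p pn e]] := IH q qn; split=> [p' p'n|]; first by rewrite E tail_cplus (negPf qa) le.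
  by exists p => //; rewrite E tail_cplus (negPf qa).
have an := ltn_ord a.
have [|le1 [p1 p1n e1]] := IH a; first by lia.
have [|le2 [p2 p2n e2]] := IH a.+2; first by lia.
split=> [p pn|].
  by rewrite E tail_cplus qa eqxx; have := le1 p pn; have := le2 p pn; lia.
have [m1|m2] := leqP (tail (pass Q I) a) (tail (pass Q I) a.+2).+1.
  exists p1 => //; rewrite E tail_cplus qa eqxx.
  by have := le2 p1 p1n; lia.
exists p2 => //; rewrite E tail_cplus qa eqxx.
by have := le1 p2 p2n; lia.
Qed.

Lemma iter_pass_le n (Q : seq 'I_n.-1) (I : {set 'I_n}) m v : (forall i, v i <= n) ->
  tail (iter m (pass Q) I) (v m) <= tail I (v 0) + cost (word_profile Q) v 0 m.
Proof.
move=> vn; elim: m => [|m IH]; first by rewrite /cost big_geq ?addn0.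
rewrite (@cost_cat _ _ 0 m m.+1) ?leqnSn // cost1 /=.
by have [le _] := pass_tail Q (iter m (pass Q) I) (vn m.+1); have := le (v m) (vn _); lia.
Qed.

Lemma iter_pass_ex n (Q : seq 'I_n.-1) (I : {set 'I_n}) m q : q <= n ->
  exists v, [/\ forall i, v i <= n, v m = q &
    tail (iter m (pass Q) I) q = tail I (v 0) + cost (word_profile Q) v 0 m].
Proof.
elim: m q => [|m IH] q qn.
  by exists (fun=> q); split=> //; rewrite /cost big_geq ?addn0.
have [_ [p pn e]] := pass_tail Q (iter m (pass Q) I) qn.
have [v [vn vm ev]] := IH p pn.
exists (fun i => if i == m.+1 then q else v i); split=> [i||]; rewrite ?eqxx //.
  by case: ifP.
rewrite (@cost_cat _ _ 0 m m.+1) ?leqnSn // cost1 /= eqxx ltn_eqF // vm e ev -addnA.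
congr (_ + (_ + _)); apply: eq_cost => i /andP[_ im]; by rewrite ltn_eqF.
Qed.

Lemma iter_pass_Rset n (Q : seq 'I_n.-1) k m : k <= n ->
  (iter m (pass Q) (Lset n k) == Rset n k) <-> covers (word_profile Q) n m k.
Proof.
move=> kn; have cL : #|Lset n k| = k by apply: card_ord_lt.
have cI : #|iter m (pass Q) (Lset n k)| = k by elim: m => //= m IH; rewrite card_pass.
have cR : #|Rset n k| = k.
  have -> : Rset n k = ~: Lset n (n - k) by apply/setP => i; rewrite !inE -leqNgt.
  by rewrite cardsCs setCK card_ord_lt ?card_ord ?leq_subr // subKn.
have nk : n - k <= n by apply: leq_subr.
split=> [/eqP E v vn|C].
  have := iter_pass_le Q (Lset n k) m vn; rewrite tail_Lset //.
  have := @tail_le n (iter m (pass Q) (Lset n k)) (n - k) (v m).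
  have : tail (iter m (pass Q) (Lset n k)) (n - k) = k.
    by rewrite E -[RHS]cR; congr #|pred_of_set _|; apply/setP => i; rewrite !inE andbb.
  have := @tail_le n (iter m (pass Q) (Lset n k)) (v m) (n - k).
  lia.
have [v [vn vm e]] := iter_pass_ex Q (Lset n k) m nk.
have := C v vn; rewrite vm subnn addn0 => Ck.
have tk : k <= tail (iter m (pass Q) (Lset n k)) (n - k) by rewrite e tail_Lset //; lia.
rewrite eqEcard cR cI leqnn andbT.
have /eqP <- : [set i in iter m (pass Q) (Lset n k) | n - k <= i] == iter m (pass Q) (Lset n k).
  rewrite eqEcard cI tk andbT; by apply/subsetP => i; rewrite inE => /andP[].
by apply/subsetP => i; rewrite !inE => /andP[].
Qed.

Lemma ele_least (P : pred nat) b : ele (least P) b <-> exists2 m, P m & m <= b.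
Proof.
rewrite /least; case: pselect => [exP|nP] /=; last first.
  by split=> // [[m Pm _]]; case: nP; exists m.
case: ex_minnP => m Pm min; split=> [mb|[m' Pm' m'b]]; first by exists m.
exact: leq_trans (min _ Pm') m'b.
Qed.

Lemma ele_passes n k (Q : seq 'I_n.-1) b : k <= n -> 0 < b ->
  ele (passes k Q) b <-> covers (word_profile Q) n b k.
Proof.
move=> kn b0; rewrite ele_least; split=> [[m /andP[m0 E] mb]|C].
  apply: covers_monotone (word_rank_profile Q) kn _ ((iter_pass_Rset Q m kn).1 E).
  by rewrite m0.
by exists b => //; rewrite b0; apply/iter_pass_Rset.
Qed.

(** * Increasing selections of rows and columns *)

Definition incr {k n : nat} (f : 'I_k -> 'I_n) : Prop := {homo f : i j / i < j}.

Lemma incr_inj k n (f : 'I_k -> 'I_n) : incr f -> injective f.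
Proof.
move=> fi i j e; apply/eqP; have [/fi|/fi|/val_inj->//] := ltngtP i j; by rewrite e ltnn.
Qed.

Lemma incr_comp k l n (f : 'I_l -> 'I_n) (g : 'I_k -> 'I_l) :
  incr f -> incr g -> incr (f \o g).
Proof. by move=> fi gi i j ij; apply/fi/gi. Qed.

Lemma incr_lift k (a : 'I_k.+1) : incr (lift a).
Proof. by move=> i j; rewrite /= /bump; case: leqP; case: leqP; lia. Qed.

Lemma incr_enum n (S : {set 'I_n}) k : #|S| = k ->
  exists2 h : 'I_k -> 'I_n, incr h & forall x, (x \in S) = [exists i, h i == x].
Proof.
move=> <-; exists (fun i => enum_val i) => [i j ij|x].
  have srt : sorted ltn [seq val x | x <- enum S].
    apply: (subseq_sorted ltn_trans) (iota_ltn_sorted 0 n); rewrite -val_enum_ord.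
    by apply: map_subseq; rewrite enumT; apply: filter_subseq.
  have sz t : t < #|S| -> t < size (enum S) by rewrite cardE.
  rewrite /enum_val -!(nth_map _ 0 val) ?sz //.
  by apply: (sorted_ltn_nth ltn_trans) => //; rewrite inE size_map sz.
apply/idP/existsP => [xS|[i /eqP<-]]; last exact: enum_valP.
by exists (enum_rank_in xS x); rewrite enum_rankK_in.
Qed.

Lemma injective_sort k n (f : 'I_k -> 'I_n) : injective f ->
  exists (h : 'I_k -> 'I_n) (s : 'S_k), incr h /\ f =1 h \o s.
Proof.
move=> fi; have [|h hi hE] := @incr_enum n [set f i | i in 'I_k] k.
  by rewrite card_imset // card_ord.
have ex i : exists j, h j == f i by apply/existsP; rewrite -hE imset_f.
pose s i := xchoose (ex i); have sE i : h (s i) = f i by apply/eqP/(xchooseP (ex i)).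
have sinj : injective s by move=> i j e; apply: fi; rewrite -!sE e.
by exists h, (perm sinj); split=> // i; rewrite /= permE sE.
Qed.

Local Open Scope ring_scope.

(** * Minors of products *)

Lemma det_alternate_rowsub (R : comNzRingType) k n (h : 'I_k -> 'I_n) (B : 'M[R]_(n, k)) :
  ~ injective h -> \det (rowsub h B) = 0.
Proof.
move=> ninj; have [/injectiveP//|/injectivePn[i [j ij e]]] := boolP (injectiveb h).
by apply: (determinant_alternate ij) => l; rewrite !mxE e.
Qed.

Lemma det_mul_rect (R : comNzRingType) k n (A : 'M[R]_(k, n)) (B : 'M[R]_(n, k)) :
  \det (A *m B) = \sum_(h : {ffun 'I_k -> 'I_n}) (\prod_i A i (h i)) * \det (rowsub h B).
Proof.
rewrite /determinant.
transitivity (\sum_(s : 'S_k) \sum_(h : {ffun 'I_k -> 'I_n})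
   (-1) ^+ s * ((\prod_i A i (h i)) * \prod_i B (h i) (s i))).
  apply: eq_bigr => s _; rewrite -mulr_sumr; congr (_ * _).
  rewrite (eq_bigr (fun i => \sum_l A i l * B l (s i))); last by move=> i _; rewrite mxE.
  by rewrite bigA_distr_bigA; apply: eq_bigr => h _; rewrite big_split.
rewrite exchange_big; apply: eq_bigr => h _; rewrite mulr_sumr; apply: eq_bigr => s _.
rewrite mulrCA; congr (_ * (_ * _)); by apply: eq_bigr => i _; rewrite mxE.
Qed.

Lemma det_rowsub_perm (R : comNzRingType) k n (h : 'I_k -> 'I_n) (s : 'S_k) (B : 'M[R]_(n, k)) :
  \det (rowsub (h \o s) B) = (-1) ^+ s * \det (rowsub h B).
Proof.
have -> : rowsub (h \o s) B = perm_mx s *m rowsub h B.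
  by rewrite -row_permE; apply/matrixP => i j; rewrite !mxE.
by rewrite det_mulmx det_perm.
Qed.

Lemma det_colsub_perm (R : comNzRingType) k n (h : 'I_k -> 'I_n) (s : 'S_k) (A : 'M[R]_(k, n)) :
  \det (colsub (h \o s) A) = (-1) ^+ s * \det (colsub h A).
Proof.
by rewrite -det_tr -[in RHS]det_tr !trmx_mxsub det_rowsub_perm.
Qed.

(** A symmetrised Cauchy-Binet formula: every increasing selection occurs here
    once for each of its k! reorderings, with the same contribution, and the
    repetitions contribute 0. For the sign questions below the factor k! is
    harmless, and no enumeration of the increasing selections is needed. *)
Lemma cauchy_binet_sym (R : comNzRingType) k n (A : 'M[R]_(k, n)) (B : 'M[R]_(n, k)) :
  \det (A *m B) *+ k`! =
  \sum_(h : {ffun 'I_k -> 'I_n}) \det (colsub h A) * \det (rowsub h B).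
Proof.
transitivity (\sum_(s : 'S_k) \det (A *m B)).
  by rewrite sumr_const card_Sn.
transitivity (\sum_(s : 'S_k) \sum_(h : {ffun 'I_k -> 'I_n})
   (-1) ^+ s * (\prod_i A i (h (s i))) * \det (rowsub h B)).
  apply: eq_bigr => s _; rewrite det_mul_rect.
  rewrite (reindex_inj (h := fun h : {ffun 'I_k -> 'I_n} => [ffun i => h (s i)])) /=; last first.
    move=> h1 h2 /ffunP e; apply/ffunP => i.
    by have := e (s^-1 i)%g; rewrite !ffunE permKV.
  apply: eq_bigr => h _.
  have e : [ffun i => h (s i)] =1 h \o s by move=> i; rewrite ffunE.
  rewrite (eq_rowsub _ e) det_rowsub_perm.
  by rewrite mulrA [_ * (-1) ^+ s]mulrC; under eq_bigr do rewrite ffunE.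
rewrite exchange_big; apply: eq_bigr => h _; rewrite -mulr_suml; congr (_ * _).
by apply: eq_bigr => s _; congr (_ * _); apply: eq_bigr => i _; rewrite mxE.
Qed.

Lemma cauchy_binet_term_ge0 (R : realType) n k (A B : 'M[R]_n) (f g : 'I_k -> 'I_n)
    (e : {ffun 'I_k -> 'I_n}) :
  totally_nonnegative A -> totally_nonnegative B -> incr f -> incr g ->
  0 <= \det (colsub e (rowsub f A)) * \det (rowsub e (colsub g B)).
Proof.
move=> tA tB fi gi.
have [/injectiveP/injective_sort [h0 [s [h0i eE]]]|/injectiveP ni] := boolP (injectiveb e); last first.
  by rewrite [X in _ * X]det_alternate_rowsub ?mulr0.
rewrite (eq_colsub _ eE) (eq_rowsub _ eE) det_colsub_perm det_rowsub_perm.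
rewrite mulrACA -signr_addb addbb mul1r -mxsubcr -mxsubrc.
by apply: mulr_ge0; [apply: tA|apply: tB].
Qed.

Lemma totally_nonnegative_mul (R : realType) n (A B : 'M[R]_n) :
  totally_nonnegative A -> totally_nonnegative B -> totally_nonnegative (A *m B).
Proof.
move=> tA tB k f g fi gi; rewrite mxsub_mul -(pmulrn_lge0 _ (fact_gt0 k)).
by rewrite cauchy_binet_sym sumr_ge0 // => e _; apply: cauchy_binet_term_ge0.
Qed.

Lemma minor_mul_gt0 (R : realType) n k (A B : 'M[R]_n) (f g h : 'I_k -> 'I_n) :
  totally_nonnegative A -> totally_nonnegative B -> incr f -> incr g ->
  0 < \det (mxsub f h A) -> 0 < \det (mxsub h g B) -> 0 < \det (mxsub f g (A *m B)).
Proof.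
move=> tA tB fi gi hA hB; rewrite mxsub_mul -(pmulrn_lgt0 _ (fact_gt0 k)).
rewrite cauchy_binet_sym (bigD1 [ffun i => h i]) //=.
have eh : [ffun i => h i] =1 h by move=> i; rewrite ffunE.
rewrite -mxsubcr -mxsubrc (eq_mxsub _ _ (fun=> erefl) eh) (eq_mxsub _ _ eh (fun=> erefl)).
apply: ltr_wpDr; last exact: mulr_gt0.
by apply: sumr_ge0 => e _; apply: cauchy_binet_term_ge0.
Qed.

(** * Row bases and bordered minors *)

Lemma row_pid_mul (F : fieldType) n p (X : 'M[F]_(n, p)) z (j : 'I_n) :
  row j ((pid_mx z : 'M_n) *m X) = if (j < z)%N then row j X else 0.
Proof.
rewrite row_mul; have [jz|zj] := ltnP j z; last first.
  suff -> : row j (pid_mx z : 'M[F]_n) = 0 by rewrite mul0mx.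
  by apply/rowP => l; rewrite !mxE ltnNge zj andbF.
rewrite (_ : row j (pid_mx z : 'M[F]_n) = delta_mx 0 j); first by rewrite -rowE.
by apply/rowP => l; rewrite !mxE jz andbT eqxx eq_sym.
Qed.

Lemma row_copid_mul (F : fieldType) n p (X : 'M[F]_(n, p)) z (j : 'I_n) :
  row j (copid_mx z *m X) = if (z <= j)%N then row j X else 0.
Proof.
rewrite mulmxBl mul1mx linearB /= row_pid_mul.
by case: leqP; rewrite ?subrr ?subr0.
Qed.

Lemma copidS_sub (F : fieldType) n p (X : 'M[F]_(n, p)) z :
  (copid_mx z.+1 *m X <= copid_mx z *m X)%MS.
Proof.
apply/row_subP => j; rewrite row_copid_mul; case: ifP => [zj|_]; last exact: sub0mx.
by have := row_sub j (copid_mx z *m X); rewrite row_copid_mul ltnW.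
Qed.

Lemma copid_mx_n (F : fieldType) n : copid_mx n = 0 :> 'M[F]_n.
Proof. by rewrite /copid_mx pid_mx_1 subrr. Qed.

Lemma copid_mx_0 (F : fieldType) n : copid_mx 0 = 1%:M :> 'M[F]_n.
Proof. by rewrite /copid_mx pid_mx_0 subr0. Qed.

Lemma tail_sum n (S : {set 'I_n}) s (h : 'I_s -> 'I_n) z : injective h ->
  (forall x, (x \in S) = [exists i, h i == x]) -> tail S z = (\sum_(i < s) (z <= h i))%N.
Proof.
move=> hi hE.
rewrite /tail -sum1_card (eq_bigl (fun x => (x \in [set h i | i in 'I_s]) && (z <= x)%N)); last first.
  move=> x; rewrite inE hE; congr andb; apply/existsP/imsetP => [[i /eqP<-]|[i _ ->]]; by exists i.
rewrite big_mkcondr /= big_imset /=; last by move=> i j _ _; apply: hi.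
by apply: eq_bigr => i _; case: leqP.
Qed.

(** Choosing rows from the bottom upwards, each row that is independent of the
    rows below it, yields a basis that restricts to a basis of the last rows, for
    every position z at once. *)
Lemma greedy_rows (F : fieldType) n p (X : 'M[F]_(n, p)) :
  exists s (h : 'I_s -> 'I_n), [/\ incr h, row_free (rowsub h X), (X <= rowsub h X)%MS &
    forall z, (z <= n)%N -> \rank (copid_mx z *m X) = (\sum_(i < s) (z <= h i))%N].
Proof.
pose S := [set j : 'I_n | ~~ (row j X <= copid_mx j.+1 *m X)%MS].
have rk d : (d <= n)%N -> \rank (copid_mx (n - d) *m X) = tail S (n - d).
  elim: d => [|d IH] dn; first by rewrite subn0 copid_mx_n mul0mx mxrank0 tailn.
  have zn : (n - d.+1 < n)%N by lia.
  pose z := Ordinal zn; have zS : (n - d = z.+1)%N by rewrite /=; lia.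
  rewrite (tail_step S z) -zS -IH ?zS; last by lia.
  have sub := copidS_sub X z.
  have rz : (row z X <= copid_mx z *m X)%MS.
    by have := row_sub z (copid_mx z *m X); rewrite row_copid_mul leqnn.
  have le : (copid_mx z *m X <= copid_mx z.+1 *m X + row z X)%MS.
    apply/row_subP => j; rewrite row_copid_mul; case: ifP => [|_]; last exact: sub0mx.
    rewrite leq_eqVlt => /orP[/eqP/val_inj<-|zj]; first exact: addsmxSr.
    apply: submx_trans (addsmxSl _ _).
    by have := row_sub j (copid_mx z.+1 *m X); rewrite row_copid_mul zj.
  rewrite inE; case: (boolP (_ <= _)%MS) => [rz'|nrz] /=.
    rewrite add0n; apply/eqP; rewrite eqn_leq !mxrankS //.
    by apply: submx_trans le _; rewrite addsmx_sub submx_refl.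
  apply/eqP; rewrite eqn_leq; apply/andP; split.
    apply: leq_trans (mxrankS le) _; apply: leq_trans (mxrank_adds_leqif _ _) _.
    by rewrite addnC leq_add2r rank_leq_row.
  rewrite add1n ltnNge; apply/negP => rle; move/negP: nrz; apply.
  by apply: submx_trans rz _; rewrite -(geq_leqif (mxrank_leqif_sup sub)).
have [h hi hE] := @incr_enum n S #|S| erefl.
have ts z : tail S z = (\sum_(i < #|S|) (z <= h i))%N by apply: tail_sum => //; apply: incr_inj.
have rowS j : j \in S -> (row j X <= rowsub h X)%MS.
  by rewrite hE => /existsP[i /eqP<-]; rewrite -row_rowsub row_sub.
have span d : (d <= n)%N -> (copid_mx (n - d) *m X <= rowsub h X)%MS.
  elim: d => [|d IH] dn; first by rewrite subn0 copid_mx_n mul0mx sub0mx.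
  have zn : (n - d.+1 < n)%N by lia.
  pose z := Ordinal zn; have zS : (n - d = z.+1)%N by rewrite /=; lia.
  have {}IH : (copid_mx z.+1 *m X <= rowsub h X)%MS by rewrite -zS; apply: IH; lia.
  apply/row_subP => j; rewrite (row_copid_mul X z); case: ifP => [|_]; last exact: sub0mx.
  rewrite leq_eqVlt => /orP[/eqP/val_inj<-|zj].
    have [/rowS//|] := boolP (z \in S); rewrite inE negbK => /submx_trans; exact.
  by apply: submx_trans IH; have := row_sub j (copid_mx z.+1 *m X); rewrite row_copid_mul zj.
have spanX : (X <= rowsub h X)%MS.
  by have := span n (leqnn n); rewrite subnn copid_mx_0 mul1mx.
exists #|S|, h; split=> //.
  rewrite /row_free eqn_leq rank_leq_row /=; apply: leq_trans (mxrankS spanX).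
  by have := rk n (leqnn n); rewrite subnn copid_mx_0 mul1mx tail0 => ->.
by move=> z zn; have := rk (n - z)%N (leq_subr _ _); rewrite subKn // ts.
Qed.

Lemma exists_minor (F : fieldType) s n (X : 'M[F]_(s, n)) : row_free X ->
  exists2 g : 'I_s -> 'I_n, incr g & \det (colsub g X) != 0.
Proof.
move=> fX; have [t [h [hi fh sp _]]] := greedy_rows X^T.
have e : t = s.
  have := mxrankS sp; rewrite mxrank_tr (eqP fX) (eqP fh) => st.
  by apply/eqP; rewrite eqn_leq st andbT -(eqP fh) rank_leq_col.
move: h hi fh {sp}; rewrite e => h hi fh; exists h => //.
by rewrite -det_tr trmx_mxsub -unitfE -unitmxE -row_free_unit.
Qed.

Definition ins {t n : nat} (a : 'I_t.+1) (x : 'I_n) (F : 'I_t -> 'I_n) (i : 'I_t.+1) : 'I_n :=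
  if unlift a i is Some i' then F i' else x.

Lemma ins_lift t n (a : 'I_t.+1) (x : 'I_n) (F : 'I_t -> 'I_n) i : ins a x F (lift a i) = F i.
Proof. by rewrite /ins liftK. Qed.

Lemma ins_eq t n (a : 'I_t.+1) (x : 'I_n) (F : 'I_t -> 'I_n) : ins a x F a = x.
Proof. by rewrite /ins unlift_none. Qed.

Lemma incr_ins t n (a : 'I_t.+1) (x : 'I_n) (F : 'I_t -> 'I_n) : incr F ->
  (forall i : 'I_t, if (i < a)%N then (F i < x)%N else (x < F i)%N) -> incr (ins a x F).
Proof.
move=> Fi H i j; case: (unliftP a i) => [i'|] ->; case: (unliftP a j) => [j'|] ->; rewrite ?ins_lift ?ins_eq.
- by move=> ij; apply: Fi; move: ij; rewrite /= /bump; do 2 case: leqP; lia.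
- by have := H i'; rewrite /= /bump; case: leqP => //; lia.
- by have := H j'; rewrite /= /bump; case: leqP => //; lia.
- by rewrite ltnn.
Qed.

Lemma exists_ins s n (f : 'I_s -> 'I_n) (y : 'I_n) : incr f -> (forall i, f i != y) ->
  exists a : 'I_s.+1, forall i : 'I_s, if (i < a)%N then (f i < y)%N else (y < f i)%N.
Proof.
move=> fi fy; pose P m := (m == s) || [exists i : 'I_s, (i == m :> nat) && (y < f i)%N].
have exP : exists m, P m by exists s; rewrite /P eqxx.
case: (ex_minnP exP) => m Pm mmin.
have ms : (m < s.+1)%N by rewrite ltnS; apply: mmin; rewrite /P eqxx.
exists (Ordinal ms) => i /=; case: ltnP => im.
  have := fy i; rewrite -val_eqE /= neq_ltn => /orP[//|yf].
  have : (m <= i)%N by apply: mmin; apply/orP; right; apply/existsP; exists i; rewrite eqxx.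
  by lia.
case/orP: Pm => [/eqP ms'|/existsP[i0 /andP[/eqP i0m yf]]].
  by have := ltn_ord i; lia.
move: im; rewrite -i0m leq_eqVlt => /orP[/eqP/val_inj<-//|/fi]; exact: ltn_trans.
Qed.

(** A combination of the rows of G that is concentrated in the single column b
    is read off in the equation G * adj G = det G. *)
Lemma det_bordered_row (R : comNzRingType) N (G : 'M[R]_N) (w : 'rV[R]_N) a b u :
  w 0 a = 1 -> w *m G = u *: delta_mx 0 b -> \det G = u * cofactor G a b.
Proof.
move=> wa wG; have := congr1 (fun X : 'rV_N => (X *m \adj G) 0 a) wG.
rewrite /= -mulmxA mul_mx_adj mul_mx_scalar -scalemxAl -rowE !mxE wa mulr1; exact.
Qed.

(** Row reduction of a bordered minor: if u differs from the row x by a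
    combination of the rows F and vanishes on the columns g, then u can replace
    the row x, and only its entry in the column c survives. *)
Lemma det_bordered (R : fieldType) n t (A : 'M[R]_n) (F g : 'I_t -> 'I_n) (x c : 'I_n)
    (a b : 'I_t.+1) (u : 'rV[R]_n) :
  (row x A - u <= rowsub F A)%MS -> (forall i, u 0 (g i) = 0) ->
  \det (mxsub (ins a x F) (ins b c g) A) = u 0 c * (-1) ^+ (a + b) * \det (mxsub F g A).
Proof.
move=> /submxP[v ve] ug.
pose w := \row_i (if unlift a i is Some i' then - v 0 i' else 1) : 'rV[R]_t.+1.
have uE l : \sum_i w 0 i * A (ins a x F i) l = u 0 l.
  rewrite (bigD1_ord a) //= mxE unlift_none mul1r ins_eq.
  have := congr1 (fun X : 'rV_n => X 0 l) ve; rewrite !mxE => /eqP.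
  rewrite subr_eq => /eqP->; rewrite addrAC -big_split big1 ?add0r // => i _ /=.
  by rewrite !mxE liftK ins_lift mulNr subrr.
rewrite (@det_bordered_row _ _ _ w a b (u 0 c)).
- rewrite /cofactor -mulrA; congr (_ * (_ * \det _)).
  by apply/matrixP => i j; rewrite !mxE !ins_lift.
- by rewrite mxE unlift_none.
apply/rowP => j; rewrite !mxE; under eq_bigr do rewrite [mxsub _ _ _ _ _]mxE.
rewrite uE; case: (unliftP b j) => [j'|] ->.
  by rewrite ins_lift ug eq_sym (negPf (neq_lift _ _)) andbF mulr0.
by rewrite ins_eq !eqxx mulr1.
Qed.

(** * Corners of totally nonnegative matrices *)

Definition corner (F : fieldType) (n : nat) (A : 'M[F]_n) (p q : nat) : nat :=
  \rank ((pid_mx p : 'M_n) *m A *m copid_mx q).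

Lemma tr_copid_mx (F : fieldType) n q : (copid_mx q)^T = copid_mx q :> 'M[F]_n.
Proof. by rewrite /copid_mx linearB /= trmx1 tr_pid_mx. Qed.

Lemma mul_copid_mxE (F : fieldType) m n (X : 'M[F]_(m, n)) q i j :
  (X *m copid_mx q) i j = if (q <= j)%N then X i j else 0.
Proof.
have := congr1 (fun Y : 'rV_m => Y 0 i) (row_copid_mul X^T q j).
rewrite mxE -[X in (X *m _)]tr_copid_mx -trmx_mul mxE => ->.
by case: ifP => _; rewrite !mxE.
Qed.

Lemma mxrank_mxsub (F : fieldType) m n k l (f : 'I_k -> 'I_m) (g : 'I_l -> 'I_n) (X : 'M[F]_(m, n)) :
  (\rank (mxsub f g X) <= \rank X)%N.
Proof.
rewrite mxsubcr -mxrank_tr trmx_mxsub; apply: leq_trans (mxrankS (rowsub_sub _ _)) _.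
by rewrite mxrank_tr mxrankS // rowsub_sub.
Qed.

Lemma rank_det_neq0 (F : fieldType) k (X : 'M[F]_k) : (\det X != 0) = (\rank X == k).
Proof. by rewrite -unitfE -unitmxE -row_free_unit. Qed.

Lemma minor_le_corner (F : fieldType) n k (A : 'M[F]_n) (f g : 'I_k -> 'I_n) p q :
  (forall i, f i < p)%N -> (forall i, q <= g i)%N -> \det (mxsub f g A) != 0 ->
  (k <= corner A p q)%N.
Proof.
move=> fp qg; rewrite rank_det_neq0 => /eqP rk.
rewrite -[X in (X <= _)%N]rk; apply: leq_trans (mxrank_mxsub f g _).
rewrite eq_leq //; congr (\rank _); apply/matrixP => i j; rewrite [LHS]mxE [RHS]mxE.
rewrite mul_copid_mxE qg.
have := congr1 (fun Y : 'rV_n => Y 0 (g j)) (row_pid_mul A p (f i)).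
by rewrite fp !mxE => ->.
Qed.

Lemma exists_right_minor (F : fieldType) n k (A : 'M[F]_n) (f : 'I_k -> 'I_n) q :
  row_free (rowsub f A *m copid_mx q) ->
  exists g : 'I_k -> 'I_n, [/\ incr g, forall i, (q <= g i)%N & \det (mxsub f g A) != 0].
Proof.
move=> /exists_minor[g gi dg].
have qg i : (q <= g i)%N.
  rewrite leqNgt; apply/negP => gq; case/eqP: dg; rewrite (expand_det_col _ i) big1 // => l _.
  by rewrite mxE mul_copid_mxE leqNgt gq mul0r.
exists g; split=> //; rewrite (_ : mxsub f g A = colsub g (rowsub f A *m copid_mx q)) //.
by apply/matrixP => i j; rewrite [RHS]mxE mul_copid_mxE qg !mxE.
Qed.

Lemma row_free_rowsub (F : fieldType) k m n (f : 'I_k -> 'I_m) (X : 'M[F]_(m, n)) :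
  injective f -> row_free X -> row_free (rowsub f X).
Proof.
move=> fi fX; rewrite /row_free rowsubE mxrankMfree //.
rewrite -/(row_free _); apply/row_freeP; exists (rowsub f 1%:M)^T.
apply/matrixP => i j; rewrite !mxE (bigD1 (f i)) //= big1 => [|l /negPf li]; rewrite !mxE.
  by rewrite eqxx mul1r addr0 eq_sym (inj_eq fi).
by rewrite eq_sym li mul0r.
Qed.

Section Sign.
Context (R : realType) (n : nat).
Implicit Types A B : 'M[R]_n.

(** Border the positive minor on the rows f and suitable columns >= q by the
    last row x and the first column c: the sign is governed by the parity of the
    number of rows f. *)
Lemma combination_sign k A (f : 'I_k -> 'I_n) (x : 'I_n) q (u : 'rV[R]_n) (c : 'I_n) :
  totally_nonnegative A -> incr f -> (forall i, f i < x)%N ->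
  row_free (rowsub f A *m copid_mx q) -> u *m copid_mx q = 0 ->
  (row x A - u <= rowsub f A)%MS -> (c < q)%N -> 0 <= (-1) ^+ k * u 0 c.
Proof.
move=> tA fi fx /exists_right_minor[g [gi qg dg]] u0 xu cq.
have dg0 : 0 < \det (mxsub f g A) by rewrite lt_neqAle eq_sym dg tA.
have ug i : u 0 (g i) = 0.
  by have := congr1 (fun Y : 'rV_n => Y 0 (g i)) u0; rewrite mul_copid_mxE qg mxE.
have := @det_bordered R n k A f g x c ord_max ord0 u xu ug.
rewrite addn0 -(pmulr_lge0 _ dg0) [_ * u 0 c]mulrC => <-; apply: tA.
  by apply: incr_ins => // i; rewrite /= ltn_ord.
by apply: incr_ins => // i /=; apply: leq_trans cq (qg i).
Qed.

(** If the row y were independent of the rows f, then [combination_sign] would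
    apply to f and to f with y inserted, which has one more row, for the same
    vector u. So u would vanish, although A is invertible. *)
Lemma span_below k A (f : 'I_k -> 'I_n) (x y : 'I_n) q :
  totally_nonnegative A -> A \in unitmx -> incr f -> (forall i, f i < x)%N ->
  row_free (rowsub f A *m copid_mx q) ->
  (row x A *m copid_mx q <= rowsub f A *m copid_mx q)%MS -> (y < x)%N ->
  (row y A *m copid_mx q <= rowsub f A *m copid_mx q)%MS.
Proof.
move=> tA uA fi fx free /submxP[v vE] yx; apply/negPn/negP => ny.
pose u := row x A - v *m rowsub f A.
have u0 : u *m copid_mx q = 0 by rewrite mulmxBl vE mulmxA subrr.
have xu : (row x A - u <= rowsub f A)%MS by rewrite subKr submxMl.
have fy i : f i != y.
  apply: contra ny => /eqP<-; rewrite -row_rowsub -row_mul row_sub //.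
have [a ha] := exists_ins fi fy.
pose F := ins a y f.
have Fi : incr F by apply: incr_ins.
have Fx i : (F i < x)%N.
  by rewrite /F; case: (unliftP a i) => [i'|] ->; rewrite ?ins_lift ?ins_eq.
have subF : (rowsub f A <= rowsub F A)%MS.
  by apply: (submx_rowsub (lift a)) => i; rewrite /F /= ins_lift.
have freeF : row_free (rowsub F A *m copid_mx q).
  rewrite /row_free eqn_leq rank_leq_row /= -[X in (X < _)%N](eqP free).
  rewrite ltn_neqAle mxrankS ?submxMr // andbT.
  apply: contra ny => /eqP e.
  have : (rowsub F A *m copid_mx q <= rowsub f A *m copid_mx q)%MS.
    by rewrite -(geq_leqif (mxrank_leqif_sup (submxMr _ subF))) e.
  apply: submx_trans; rewrite -[y](ins_eq a y f) -row_rowsub -row_mul row_sub //.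
have u00 c : u 0 c = 0.
  have [qc|cq] := leqP q c.
    by have := congr1 (fun Y : 'rV_n => Y 0 c) u0; rewrite mul_copid_mxE qc => ->; rewrite mxE.
  have := combination_sign tA fi fx free u0 xu cq.
  have := combination_sign tA Fi Fx freeF u0 (submx_trans xu subF) cq.
  rewrite exprS mulN1r mulNr oppr_ge0 => le ge.
  have /eqP : (-1) ^+ k * u 0 c = 0 by apply: le_anti; rewrite le ge.
  by rewrite mulf_eq0 signr_eq0 => /eqP.
have : u *m invmx A = 0 by rewrite (_ : u = 0) ?mul0mx //; apply/rowP => c; rewrite u00 mxE.
rewrite /u rowE (rowsubE f A) mulmxA -mulmxBl mulmxK // => /rowP/(_ x).
rewrite !mxE !eqxx big1 => [|i _]; first by rewrite subr0 => /eqP; rewrite oner_eq0.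
by rewrite !mxE (_ : (f i == x) = false) ?mulr0 // -val_eqE /= ltn_eqF.
Qed.

(** The converse inequality holds for every z, by subadditivity of the rank. The
    z that achieves equality comes just after the last row that depends on its
    predecessors: by [span_below] those predecessors span all rows up to it. *)
Lemma rank_rows k A (f : 'I_k -> 'I_n) q :
  totally_nonnegative A -> A \in unitmx -> incr f ->
  exists2 z, (z <= n)%N &
    ((\sum_(i < k) (z <= f i)) + corner A z q <= \rank (rowsub f A *m copid_mx q)%R)%N.
Proof.
move=> tA uA; elim: k f => [|k IH] f fi.
  by exists 0%N => //; rewrite big_ord0 /corner pid_mx_0 !mul0mx mxrank0.
pose w := widen_ord (leqnSn k); pose x := f ord_max; pose f' := f \o w.
have wi : incr w by [].
have f'i : incr f' by apply: incr_comp.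
have f'x i : (f' i < x)%N by apply: fi; exact: (ltn_ord i).
have subf : (rowsub f' A *m copid_mx q <= rowsub f A *m copid_mx q)%MS.
  by apply: submxMr; apply: (submx_rowsub w).
have [xs|nxs] := boolP (row x A *m copid_mx q <= rowsub f' A *m copid_mx q)%MS.
  exists x.+1 => //; rewrite big1 => [|i _]; last first.
    apply/eqP; rewrite eqb0 -leqNgt; have [ik|ki] := ltnP i k.
      by apply: ltnW; apply: fi.
    by rewrite (_ : i = ord_max) //; apply: val_inj => /=; have := ltn_ord i; lia.
  rewrite add0n; apply: leq_trans (mxrankS subf).
  have [s [h [hi free sp _]]] := greedy_rows (rowsub f' A *m copid_mx q).
  have hE : rowsub h (rowsub f' A *m copid_mx q) = rowsub (f' \o h) A *m copid_mx q.
    by rewrite -mul_rowsub_mx -rowsub_comp.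
  rewrite hE in free sp.
  have subh : (rowsub (f' \o h) A *m copid_mx q <= rowsub f' A *m copid_mx q)%MS.
    by apply: submxMr; apply: rowsub_comp_sub.
  apply: mxrankS; apply: submx_trans subh; apply/row_subP => y.
  rewrite -mulmxA row_pid_mul; case: ifP => [|_]; last exact: sub0mx.
  rewrite row_mul ltnS leq_eqVlt => /orP[/eqP/val_inj->|yx].
    exact: submx_trans xs sp.
  apply: (@span_below _ _ _ x) => //; first exact: incr_comp.
    by move=> i; apply: f'x.
  exact: submx_trans xs sp.
have [z zn le] := IH f' f'i; exists z => //.
rewrite big_ord_recr /= addnAC.
have lt : (\rank (rowsub f' A *m copid_mx q) < \rank (rowsub f A *m copid_mx q))%N.
  rewrite ltn_neqAle mxrankS // andbT; apply: contra nxs => /eqP e.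
  have : (rowsub f A *m copid_mx q <= rowsub f' A *m copid_mx q)%MS.
    by rewrite -(geq_leqif (mxrank_leqif_sup subf)) e.
  by apply: submx_trans; rewrite -row_rowsub -row_mul row_sub.
apply: leq_trans lt; rewrite -[X in (_ <= X)%N]addn1; apply: leq_add; first exact: le.
exact: leq_b1.
Qed.

(** The bottom-up choice of columns in the first p rows of A gives an increasing
    selection h that counts the corners (p, z) of A for all z. Its rows in B are
    handled by [rank_rows], and minors of A and B that meet in columns of h
    produce a positive minor of A *m B because nothing cancels. *)
Lemma corner_mul_ge A B p q :
  totally_nonnegative A -> totally_nonnegative B -> A \in unitmx -> B \in unitmx ->
  (p <= n)%N ->
  exists2 z, (z <= n)%N & (corner A p z + corner B z q <= corner (A *m B) p q)%N.
Proof.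
move=> tA tB uA uB pn.
pose w := widen_ord pn; pose X := rowsub w A.
have wi : incr w by [].
have freeX : row_free X.
  by apply: row_free_rowsub; [exact: incr_inj|rewrite row_free_unit].
have [s [h [hi free sp cnt]]] := greedy_rows X^T.
have e : s = p.
  have := mxrankS sp; rewrite mxrank_tr (eqP freeX) (eqP free) => ps.
  by apply/eqP; rewrite eqn_leq ps andbT -(eqP free) rank_leq_col.
move: h hi free sp cnt; rewrite e => h hi free _ cnt {s e}.
have [z zn le] := rank_rows q tB uB hi.
exists z => //; apply: leq_trans (_ : (\rank (rowsub h B *m copid_mx q) <= _)%N).
  apply: leq_trans le; rewrite leq_add2r -cnt //.
  rewrite -[X in (_ <= X)%N]mxrank_tr trmx_mul trmxK tr_copid_mx.
  apply: mxrankS; apply: submxMr; apply/row_subP => i; rewrite row_pid_mul.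
  case: ifP => [ip|_]; last exact: sub0mx.
  by rewrite (_ : i = w (Ordinal ip)) -?row_rowsub ?row_sub //; apply: val_inj.
have [r [k2 [k2i free2 sp2 _]]] := greedy_rows (rowsub h B *m copid_mx q).
have -> : \rank (rowsub h B *m copid_mx q) = r.
  apply/eqP; rewrite eqn_leq -{2}(eqP free2) mxrankS ?rowsub_sub // andbT.
  by apply: leq_trans (mxrankS sp2) _; rewrite rank_leq_row.
have hE : rowsub k2 (rowsub h B *m copid_mx q) = rowsub (h \o k2) B *m copid_mx q.
  by rewrite -mul_rowsub_mx -rowsub_comp.
rewrite hE in free2.
have [g [gi qg dg]] := exists_right_minor free2.
have [k3 k3i dk3] : exists2 k3 : 'I_r -> 'I_p, incr k3 & \det (mxsub k3 (h \o k2) X) != 0.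
  have free3 : row_free (rowsub (h \o k2) X^T).
    rewrite rowsub_comp; apply: row_free_rowsub => //; exact: incr_inj.
  have [k3 k3i dk3] := exists_minor free3; exists k3 => //.
  by rewrite -det_tr trmx_mxsub mxsubcr.
have dA : 0 < \det (mxsub (w \o k3) (h \o k2) A).
  rewrite lt_neqAle eq_sym; apply/andP; split; last by apply: tA; apply: incr_comp.
  by move: dk3; rewrite -mxsub_comp.
have dB : 0 < \det (mxsub (h \o k2) g B).
  rewrite lt_neqAle eq_sym; apply/andP; split; last by apply: tB => //; apply: incr_comp.
  by move: dg.
have wk : incr (w \o k3) by apply: incr_comp.
apply: (@minor_le_corner _ _ _ _ (w \o k3) g) => //; first by move=> i /=.
by rewrite gt_eqF // (minor_mul_gt0 tA tB wk gi dA dB).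
Qed.

End Sign.

Lemma corner_profile (F : fieldType) n (A : 'M[F]_n) : A \in unitmx -> rank_profile n (corner A).
Proof.
move=> uA; have fA : row_free A by rewrite row_free_unit.
have pidn : (pid_mx n : 'M[F]_n) = 1%:M by rewrite pid_mx_1.
split=> [p1 p2 q1 q2 p12 p2n q12 q2n|p pn|p pn|q qn|q qn]; rewrite /corner.
- have pE : (pid_mx p1 : 'M[F]_n) = (pid_mx p1 : 'M[F]_n) *m (pid_mx p2 : 'M[F]_n).
    by rewrite mul_pid_mx; congr pid_mx; lia.
  have qE : copid_mx q2 = copid_mx q1 *m copid_mx q2 :> 'M[F]_n.
    rewrite /copid_mx mulmxBl mulmxBr mulmxBr !mul1mx mulmx1 mul_pid_mx.
    rewrite (_ : minn n (minn q1 q2) = q1); last by lia.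
    by rewrite subrr subr0.
  have := mxrank_Frobenius (pid_mx p1 : 'M[F]_n) (pid_mx p2 *m A *m copid_mx q1) (copid_mx q2 : 'M[F]_n).
  by rewrite -!mulmxA -qE !mulmxA -pE addnC => /leq_trans; apply; rewrite addnC.
- by rewrite copid_mx_0 mulmx1 mxrankMfree // rank_pid_mx.
- by rewrite copid_mx_n mulmx0 mxrank0.
- by rewrite pid_mx_0 !mul0mx mxrank0.
- by rewrite pidn mul1mx eqmxMfull ?row_full_unit // rank_copid_mx.
Qed.

Lemma corner_mul_le (F : fieldType) n (A B : 'M[F]_n) p q z :
  (corner (A *m B) p q <= corner A p z + corner B z q)%N.
Proof.
rewrite /corner.
have -> : pid_mx p *m (A *m B) *m copid_mx q =
    pid_mx p *m A *m copid_mx z *m (B *m copid_mx q) +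
    pid_mx p *m A *m ((pid_mx z : 'M[F]_n) *m B *m copid_mx q) :> 'M[F]_n.
  by rewrite -!mulmxA -!mulmxDr -mulmxDl /copid_mx subrK mul1mx !mulmxA.
apply: leq_trans (mxrank_add _ _) _; apply: leq_add; first exact: mxrankM_maxl.
exact: mxrankM_maxr.
Qed.

Lemma exp_mxSr (F : fieldType) n (A : 'M[F]_n) m : A ^+ m.+1 = A ^+ m *m A.
Proof. exact: exprSr. Qed.

Lemma unitmx_exp (F : fieldType) n (A : 'M[F]_n) m : A \in unitmx -> A ^+ m \in unitmx.
Proof.
move=> uA; elim: m => [|m IH]; first by rewrite expr0 unitmx1.
by rewrite exp_mxSr unitmx_mul IH uA.
Qed.

Lemma corner1 (F : fieldType) n p : corner (1%:M : 'M[F]_n) p p = 0%N.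
Proof.
rewrite /corner mulmx1; have [pn|np] := leqP p n; first by rewrite mul_pid_mx_copid ?mxrank0.
have -> : copid_mx p = 0 :> 'M[F]_n; last by rewrite mulmx0 mxrank0.
by rewrite /copid_mx -pid_mx_minv (minn_idPl (ltnW np)) pid_mx_1 subrr.
Qed.

Lemma corner_exp_le (F : fieldType) n (A : 'M[F]_n) m (v : nat -> nat) :
  (corner (A ^+ m) (v 0) (v m) <= cost (corner A) v 0 m)%N.
Proof.
elim: m => [|m IH]; first by rewrite expr0 corner1.
rewrite exp_mxSr (@cost_cat _ _ 0 m m.+1) ?leqnSn // cost1.
by apply: leq_trans (corner_mul_le _ _ _ _ (v m)) _; rewrite leq_add2r.
Qed.

Lemma totally_nonnegative_exp (R : realType) n (A : 'M[R]_n) m :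
  totally_nonnegative A -> totally_nonnegative (A ^+ m.+1).
Proof.
move=> tA; elim: m => [|m IH]; first by rewrite expr1.
by rewrite exp_mxSr; apply: totally_nonnegative_mul.
Qed.

Lemma corner_exp_ge (R : realType) n (A : 'M[R]_n) m p q :
  totally_nonnegative A -> A \in unitmx -> (p <= n)%N -> (q <= n)%N ->
  exists v, [/\ forall i, (v i <= n)%N, v 0 = p, v m.+1 = q &
    (cost (corner A) v 0 m.+1 <= corner (A ^+ m.+1) p q)%N].
Proof.
move=> tA uA pn; elim: m q => [|m IH] q qn.
  exists (fun i => if i == 0 then p else q); split=> // [i|]; first by case: ifP.
  by rewrite cost1 expr1.
have [z zn le] := corner_mul_ge q
  (totally_nonnegative_exp m tA) tA (unitmx_exp m.+1 uA) uA pn.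
have [v [vn v0 vm ev]] := IH z zn.
exists (fun i => if i == m.+2 then q else v i); split=> [i|||]; rewrite ?eqxx //.
  by case: ifP.
rewrite exp_mxSr; apply: leq_trans le.
rewrite (@cost_cat _ _ 0 m.+1 m.+2) ?leqnSn // cost1 /= eqxx ltn_eqF // vm leq_add2r.
apply: leq_trans ev; rewrite eq_leq //; apply: eq_cost => i /andP[_ im]; by rewrite ltn_eqF.
Qed.

Lemma covers_corner (R : realType) n (A : 'M[R]_n) m k :
  totally_nonnegative A -> A \in unitmx -> (k <= n)%N -> (0 < m)%N ->
  covers (corner A) n m k <-> (k <= corner (A ^+ m) k (n - k))%N.
Proof.
case: m => // m tA uA kn _; have nk : (n - k <= n)%N by apply: leq_subr.
split=> [C|le v vn].
  have [v [vn v0 vm ev]] := corner_exp_ge m tA uA kn nk.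
  by have := C v vn; rewrite v0 vm !subnn !addn0 => /leq_trans; apply.
have H : rank_profile n (corner (A ^+ m.+1)) by apply: corner_profile; apply: unitmx_exp.
have le2 : (corner (A ^+ m.+1) (v 0) (v m.+1) <= cost (corner A) v 0 m.+1)%N.
  exact: corner_exp_le.
have v0 := vn 0%N; have vm := vn m.+1.
have := @profile_rows n _ k (v 0%N) (n - k) H; have := @profile_rows n _ (v 0%N) k (n - k) H.
have := @profile_cols n _ (v 0%N) (n - k) (v m.+1) H v0.
have := @profile_cols n _ (v 0%N) (v m.+1) (n - k) H v0.
move: le le2 kn nk v0 vm; clear; lia.
Qed.

Lemma leq_incr k n (f : 'I_k -> 'I_n) (i j : 'I_k) : incr f -> (i <= j)%N -> (f i + (j - i) <= f j)%N.
Proof.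
move=> fi ij; move e: (j - i)%N => d; elim: d j e ij => [|d IH] j e ij.
  by have -> : i = j by [apply: val_inj => /=; lia]; rewrite addn0.
have j'k : (j.-1 < k)%N by have := ltn_ord j; lia.
have := IH (Ordinal j'k) => /=.
have : (f (Ordinal j'k) < f j)%N by apply: fi => /=; lia.
lia.
Qed.

Section Corners.
Context (R : realType) (n j : nat) (jn : (j <= n)%N).

Definition last_rows (i : 'I_j) : 'I_n := cast_ord (subnK jn) (rshift (n - j) i).
Definition first_rows (i : 'I_j) : 'I_n := widen_ord jn i.

Lemma incr_last_rows : incr last_rows.
Proof. by move=> x y; rewrite /= ltn_add2l. Qed.

Lemma last_rows_uniq (g : 'I_j -> 'I_n) : incr g -> (forall i, n - j <= g i)%N -> g =1 last_rows.
Proof.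
move=> gi ng i; apply: val_inj => /=.
have i0 : (0 < j)%N by have := ltn_ord i; lia.
have := @leq_incr _ _ g (Ordinal i0) i gi (leq0n _); have := ng (Ordinal i0).
have il : (j.-1 < j)%N by lia.
have := @leq_incr _ _ g i (Ordinal il) gi; have := ltn_ord (g (Ordinal il)); have := ltn_ord i.
move: jn => /=; lia.
Qed.

(** The rows f dominate the first rows, hence [rank_rows] gives full rank on
    the last j columns once the first rows have full rank there. *)
Lemma minor_last_columns (M : 'M[R]_n) (f : 'I_j -> 'I_n) :
  totally_nonnegative M -> M \in unitmx -> (j <= corner M j (n - j))%N -> incr f ->
  0 < \det (mxsub f last_rows M).
Proof.
move=> tM uM cM fi.
have [z zn le] := rank_rows (n - j) tM uM fi.
have H := corner_profile uM.
have cz : (minn z j <= corner M z (n - j))%N.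
  have := @profile_rows n _ z j (n - j) H; have := @profile_rows n _ j z (n - j) H.
  by move: cM zn jn; clear; lia.
have cnt : (j - z <= \sum_(i < j) (z <= f i))%N.
  apply: (@leq_trans (\sum_(i < j) (z <= i))).
    rewrite -(big_mkord xpredT (fun i => (z <= i)%N : nat)) /=.
    clear; elim: j => [|d IH]; first by rewrite big_geq.
    by rewrite big_nat_recr //=; case: leqP IH; lia.
  apply: leq_sum => i _.
  have i0 : (0 < j)%N by have := ltn_ord i; lia.
  have := @leq_incr _ _ f (Ordinal i0) i fi (leq0n _) => /=.
  by case: (leqP z i); case: (leqP z (f i)); lia.
have free : row_free (rowsub f M *m copid_mx (n - j)).
  rewrite /row_free eqn_leq rank_leq_row /=; apply: leq_trans le.
  by move: cz cnt; clear; lia.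
have [g [gi ng dg]] := exists_right_minor free.
rewrite lt_neqAle tM //; last exact: incr_last_rows.
by rewrite andbT eq_sym -(eq_mxsub _ _ (fun=> erefl) (last_rows_uniq gi ng)).
Qed.

End Corners.

(** * All minors of a given order *)

Definition raisable {k n : nat} (f : 'I_k -> 'I_n) (a : 'I_k) (y : 'I_n) : Prop :=
  (f a < y)%N /\ forall i : 'I_k, (a < i)%N -> (y < f i)%N.

Definition raise {k n : nat} (f : 'I_k.+1 -> 'I_n) (a : 'I_k.+1) (y : 'I_n) : 'I_k.+1 -> 'I_n :=
  ins a y (f \o lift a).

Lemma incr_raise k n (f : 'I_k.+1 -> 'I_n) a y : incr f -> raisable f a y -> incr (raise f a y).
Proof.
move=> fi [ay yf]; apply: incr_ins => [|i]; first by apply: incr_comp fi (@incr_lift _ _).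
case: ltnP => ia; last by apply: yf; rewrite /= /bump ia; lia.
by apply: ltn_trans ay; apply: fi; rewrite /= /bump; case: leqP => //; lia.
Qed.

Lemma raise_id k n (f : 'I_k.+1 -> 'I_n) a : f =1 ins a (f a) (f \o lift a).
Proof. by move=> i; case: (unliftP a i) => [i'|] ->; rewrite ?ins_lift ?ins_eq. Qed.

(** Were the minor (f, g) zero, some combination u of the rows f would vanish on
    the columns g, with a nonzero coefficient at f a. The minor (f, raise g) gives
    its entry in the column d a definite sign; but the minor with y added to f
    and d added to g is that entry times the minor (raise f, g), up to the
    opposite sign, and would be negative. *)
Lemma raise_minor (R : realType) n k (M : 'M[R]_n) (f g : 'I_k.+1 -> 'I_n) a b y d :
  totally_nonnegative M -> incr f -> incr g -> raisable f a y -> raisable g b d ->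
  0 < \det (mxsub (raise f a y) g M) -> 0 < \det (mxsub f (raise g b d) M) ->
  0 < \det (mxsub f g M).
Proof.
move=> tM fi gi fa gb df dg.
rewrite lt_neqAle tM // andbT eq_sym; apply/negP => /det0P[al al0 alM].
have f'i := incr_raise fi fa; have g'i := incr_raise gi gb.
have alE l : \sum_i al 0 i * M (f i) (g l) = 0.
  have := congr1 (fun X : 'rV_k.+1 => X 0 l) alM; rewrite !mxE => e; rewrite -[RHS]e.
  by apply: eq_bigr => i _; rewrite !mxE.
have ala : al 0 a != 0.
  apply/negP => /eqP ala; case/negP: (lt0r_neq0 df); apply/det0P; exists al => //.
  apply/rowP => l; rewrite !mxE -[RHS](alE l); apply: eq_bigr => i _; rewrite !mxE.
  by case: (unliftP a i) => [i'|] ->; rewrite ?ala ?mul0r // /raise ins_lift.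
pose f0 := f \o lift a; pose g0 := g \o lift b.
pose u : 'rV[R]_n := (al 0 a)^-1 *: (al *m rowsub f M).
have ug l : u 0 (g l) = 0.
  rewrite !mxE; under eq_bigr do rewrite [rowsub _ _ _ _]mxE.
  by rewrite alE mulr0.
have fu : (row (f a) M - u <= rowsub f0 M)%MS.
  have -> : row (f a) M - u = - (al 0 a)^-1 *: ((\row_i al 0 (lift a i)) *m rowsub f0 M).
    apply/rowP => l; rewrite !mxE (bigD1_ord a) //= !mxE mulrDr mulKf //.
    rewrite opprD addrA subrr add0r.
    rewrite mulNr (eq_bigr (fun j => (\row_i al 0 (lift a i)) 0 j * rowsub f0 M j l)) // => i _.
    by rewrite !mxE.
  by rewrite scalemx_sub // submxMl.
have u0 i : u 0 (g0 i) = 0 by apply: ug.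
(* The row f a is returned to f0, and the column d is added to g0. *)
have E1 := @det_bordered R n k M f0 g0 (f a) d a b u fu u0.
have fu' : (row (f a) M - u <= rowsub (raise f a y) M)%MS.
  apply: submx_trans fu _; apply: (submx_rowsub (lift a)) => i.
  by rewrite /= /raise ins_lift.
(* The row f a is inserted before y, and the column d after g b: the position of
   the column has moved by one, whence the opposite sign. *)
have E2 := @det_bordered R n k.+1 M (raise f a y) g (f a) d (widen_ord (leqnSn _) a) (lift ord0 b) u fu' ug.
have F1 : 0 < u 0 d * (-1) ^+ (a + b).
  have := dg; rewrite (eq_mxsub _ _ (raise_id f a) (fun=> erefl)) /raise E1.
  rewrite pmulr_lgt0 // lt_neqAle tM ?andbT.
  - rewrite eq_sym; apply/negP => /eqP z; move: dg.
    by rewrite (eq_mxsub _ _ (raise_id f a) (fun=> erefl)) /raise E1 z mulr0 ltxx.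
  - exact: incr_comp fi (@incr_lift _ _).
  - exact: incr_comp gi (@incr_lift _ _).
have : 0 <= u 0 d * (-1) ^+ (a + b.+1) * \det (mxsub (raise f a y) g M).
  rewrite -[(a + b.+1)%N]/((widen_ord (leqnSn _) a : 'I_k.+2) + (lift ord0 b : 'I_k.+2))%N -E2.
  apply: tM.
    apply: incr_ins => // i /=; case: fa => ay yf; case: ltnP => ia.
      have -> : raise f a y i = f i; last exact: fi.
      rewrite /raise; case: (unliftP a i) ia => [i'|] ->; rewrite ?ins_lift ?ltnn //.
    apply: leq_trans ay _; rewrite /raise; case: (unliftP a i) ia => [i'|] -> ia;
      rewrite ?ins_lift ?ins_eq //=.
    by apply/ltnW/yf; move: ia; rewrite /= /bump; case: leqP => //; lia.
  apply: incr_ins => // i /=; case: gb => bd dg'; rewrite /bump /= add1n ltnS.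
  have [ib|ib] := leqP i b; last exact: dg'.
  apply: leq_ltn_trans bd; move: ib; rewrite leq_eqVlt => /orP[/eqP/val_inj->//|/gi]; exact: ltnW.
rewrite pmulr_lge0 // addnS exprS mulN1r mulrN oppr_ge0 => /(lt_le_trans F1); by rewrite ltxx.
Qed.

(** The last row that is not in its extreme position can move down by one. *)
Lemma exists_raisable n k (jn : (k <= n)%N) (f : 'I_k -> 'I_n) : incr f ->
  ~ (f =1 last_rows jn) -> exists a y, raisable f a y.
Proof.
move=> fi nf; pose L := last_rows jn.
have fL i : (f i <= L i)%N.
  have i0 : (k.-1 < k)%N by have := ltn_ord i; lia.
  have := @leq_incr _ _ f i (Ordinal i0) fi; have := ltn_ord (f (Ordinal i0)).
  have := ltn_ord i; have := jn => /=; lia.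
have [a0 fa0] : exists a, (f a < L a)%N.
  apply: contrapT => /forallNP h; apply: nf => i; apply/val_inj/eqP.
  by rewrite eqn_leq fL leqNgt; apply/negP; apply: h.
case: (@arg_maxnP _ a0 (fun a => f a < L a)%N (fun a : 'I_k => a : nat) fa0) => a fa amax.
have yn : ((f a).+1 < n)%N by apply: leq_ltn_trans fa (ltn_ord _).
exists a, (Ordinal yn); split=> //= i ai.
have -> : f i = L i.
  apply/val_inj/eqP; rewrite eqn_leq fL leqNgt /=; apply/negP => /amax; lia.
by apply: leq_ltn_trans fa _; apply: incr_last_rows.
Qed.

(** Rows and columns are raised one unit at a time until either selection
    consists of the last k indices, where a corner hypothesis applies to M or to
    its transpose. *)
Lemma minors_gt0_of_corners (R : realType) n k (M : 'M[R]_n) : (k <= n)%N ->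
  totally_nonnegative M -> M \in unitmx ->
  (k <= corner M k (n - k))%N -> (k <= corner M^T k (n - k))%N -> minors_gt0 k M.
Proof.
move=> kn tM uM cM cMt f g.
have tMt : totally_nonnegative M^T.
  by move=> l p q pi qi; rewrite -det_tr trmx_mxsub trmxK; apply: tM.
have uMt : M^T \in unitmx by rewrite unitmx_tr.
case: k kn cM cMt f g => [|k] kn cM cMt f g; first by rewrite det_mx00 ltr01.
have [N] := ubnP (\sum_i (n - f i) + \sum_i (n - g i))%N.
elim: N f g => // N IH f g leN fi gi.
have [fL|nfL] := pselect (f =1 last_rows kn).
  rewrite -det_tr trmx_mxsub (eq_mxsub _ _ (fun=> erefl) fL).
  exact: minor_last_columns.
have [gL|ngL] := pselect (g =1 last_rows kn).
  by rewrite (eq_mxsub _ _ (fun=> erefl) gL); apply: minor_last_columns.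
have [a [y fa]] := exists_raisable fi nfL.
have [b [d gb]] := exists_raisable gi ngL.
have lower (h : 'I_k.+1 -> 'I_n) (c : 'I_k.+1) (z : 'I_n) : raisable h c z ->
    (\sum_i (n - raise h c z i) < \sum_i (n - h i))%N.
  move=> [cz _]; rewrite !(bigD1_ord c) //= /raise ins_eq.
  rewrite (eq_bigr (fun i => n - h (lift c i))%N) => [|i _]; last by rewrite ins_lift.
  by rewrite ltn_add2r ltn_sub2l // (leq_ltn_trans _ (ltn_ord z)) // ltnW.
apply: (@raise_minor R n k M f g a b y d) => //.
  by apply: IH => //; [have := lower _ _ _ fa; move: leN; clear; lia|apply: incr_raise].
by apply: IH => //; [have := lower _ _ _ gb; move: leN; clear; lia|apply: incr_raise].
Qed.

(** * Exponents of oscillatory matrices *)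

Lemma oscillatory_unitmx (R : realType) n (A : 'M[R]_n) : oscillatory A -> A \in unitmx.
Proof.
move=> [_ [m [m0 tp]]].
have : 0 < \det (mxsub id id (A ^+ m)) by apply: tp.
rewrite mxsub_id => /lt0r_neq0; case: m m0 {tp} => // m _.
by rewrite exp_mxSr det_mulmx mulf_eq0 negb_or => /andP[_]; rewrite unitmxE unitfE.
Qed.

Lemma trmx_exp (R : comNzRingType) n (A : 'M[R]_n) m : (A ^+ m)^T = A^T ^+ m.
Proof.
elim: m => [|m IH]; first by rewrite !expr0 trmx1.
by rewrite [in LHS]exprS exprSr -IH trmx_mul.
Qed.

Lemma ele_exponent (R : realType) n (A : 'M[R]_n) k b : oscillatory A -> (k <= n)%N -> (0 < b)%N ->
  ele (exponent k A) b <-> covers (corner A) n b k /\ covers (corner A^T) n b k.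
Proof.
move=> oA kn b0; have uA := oscillatory_unitmx oA; have tA := oA.1.
have uAt : A^T \in unitmx by rewrite unitmx_tr.
have tAt : totally_nonnegative A^T.
  by move=> l p q pi qi; rewrite -det_tr trmx_mxsub trmxK; apply: tA.
rewrite /exponent ele_least; split=> [[m /andP[m0 /asboolP pos] mb]|[C Ct]].
  have first_i : incr (first_rows kn) by [].
  have last_i := @incr_last_rows n k kn.
  split.
    apply: (@covers_monotone n _ m); rewrite ?m0 //; first exact: corner_profile.
    apply/covers_corner => //; apply: (@minor_le_corner _ _ _ _ (first_rows kn) (last_rows kn)).
    - by move=> i /=.
    - by move=> i /=; rewrite leq_addr.
    - by rewrite lt0r_neq0 // pos.
  apply: (@covers_monotone n _ m); rewrite ?m0 //; first exact: corner_profile.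
  apply/covers_corner => //; apply: (@minor_le_corner _ _ _ _ (first_rows kn) (last_rows kn)).
  - by move=> i /=.
  - by move=> i /=; rewrite leq_addr.
  - by rewrite -trmx_exp -trmx_mxsub det_tr lt0r_neq0 // pos.
exists b => //; rewrite b0; apply/asboolP.
have tAb : totally_nonnegative (A ^+ b) by case: b b0 C Ct => // b _ _ _; apply: totally_nonnegative_exp.
apply: minors_gt0_of_corners => //; first exact: unitmx_exp.
  by apply/covers_corner.
by rewrite trmx_exp; apply/covers_corner.
Qed.

(** * The theorem *)

Local Close Scope ring_scope.

Theorem theorem8p10 (R : realType) (n k : nat) (hk : 3 <= k <= n - 3) :
  (forall Q : seq 'I_n.-1,
     ele (passes k Q) 2 ->
     forall j : nat, 2 <= j <= n - 2 ->
       ele (passes j Q) (2 + uphalf `|j - k|)) /\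
  (forall A : 'M[R]_n, oscillatory A ->
     ele (exponent k A) 2 ->
     forall j : nat, 2 <= j <= n - 2 ->
       ele (exponent j A) (2 + uphalf `|j - k|)).
Proof.
have kn : k <= n by move: hk; clear; lia.
split=> [Q|A oA].
  move/(@ele_passes n k Q 2 kn isT) => C j hj.
  apply/ele_passes => //; first by move: hj; clear; lia.
  exact: covers_dist (word_rank_profile Q) C hk hj.
move/(@ele_exponent R n A k 2 oA kn isT) => [C Ct] j hj.
have uA := oscillatory_unitmx oA.
apply/ele_exponent => //; first by move: hj; clear; lia.
split; first exact: covers_dist (corner_profile uA) C hk hj.
apply: covers_dist Ct hk hj; apply: corner_profile; by rewrite unitmx_tr.
Qed.
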